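(* Every paired wreath is a Hopf datum: if $(B,F)$ is a paired wreath over a 0-cell $\mathcal A$ of a 2-category $\mathcal K$ (with $\eta_M$ and $\varepsilon'_C$ canonical), then $B$ and $F$ together with the 2-cells $m_B,\eta_B,\Delta_B,\varepsilon_B,m_F,\eta_F,\Delta_F,\varepsilon_F,l,r,c,d,\sigma,\rho',\tau_{X,Y}$ of the paired wreath form a Hopf datum in $\mathcal K$, whose associated 2-cells $\psi,\phi',\mu_M,\Delta'_C$ are those of the paired wreath.
   Context: CONVENTIONS. Fix a 2-category $\mathcal K$ and a 0-cell $\mathcal A$. All 1-cells are 1-cells $\mathcal A\to\mathcal A$; $XY$ is the composite of 1-cells and $1=\mathrm{id}_{\mathcal A}$. For 2-cells, $\circ$ is vertical composition ($g\circ f$: first $f$, then $g$) and $\otimes$ is horizontal composition, with left-to-right order matching the order of letters in $XY$; a 1-cell also denotes its identity 2-cell. So all identities live in the strict monoidal category $\mathcal K(\mathcal A,\mathcal A)$, and monads/comonads are monoids/comonoids there. DISTRIBUTIVE LAWS. For 1-cells $X,Y$ equipped with 2-cells $m_X:XX\to X$, $\eta_X:1\to X$, $\Delta_X:X\to XX$, $\varepsilon_X:X\to 1$ and similarly for $Y$, a 2-cell $\tau:XY\to YX$ is a left and right monadic and comonadic distributive law if $\tau\circ(m_X\otimes Y)=(Y\otimes m_X)\circ(\tau\otimes X)\circ(X\otimes\tau)$, $\tau\circ(\eta_X\otimes Y)=Y\otimes\eta_X$; $\tau\circ(X\otimes m_Y)=(m_Y\otimes X)\circ(Y\otimes\tau)\circ(\tau\otimes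 Y)$, $\tau\circ(X\otimes\eta_Y)=\eta_Y\otimes X$; $(Y\otimes\tau)\circ(\tau\otimes Y)\circ(X\otimes\Delta_Y)=(\Delta_Y\otimes X)\circ\tau$, $(\varepsilon_Y\otimes X)\circ\tau=X\otimes\varepsilon_Y$; $(\tau\otimes X)\circ(X\otimes\tau)\circ(\Delta_X\otimes Y)=(Y\otimes\Delta_X)\circ\tau$, $(Y\otimes\varepsilon_X)\circ\tau=\varepsilon_X\otimes Y$. $\tau$-BIMONAD. A 1-cell $X$ which is a monad $(m,\eta)$ and a comonad $(\Delta,\varepsilon)$, with a left and right monadic and comonadic distributive law $\tau:XX\to XX$, such that $\varepsilon\circ m=\varepsilon\otimes\varepsilon$, $\Delta\circ\eta=\eta\otimes\eta$, $\varepsilon\circ\eta=\mathrm{id}_1$, $\Delta\circ m=(m\otimes m)\circ(X\otimes\tau\otimes X)\circ(\Delta\otimes\Delta)$. LEFT WREATH. For a monad $B$, $(F,\psi:BF\to FB,\mu_M:FF\to FB,\eta_M:1\to FB)$ is a left wreath around $B$ if $\psi\circ(m_B\otimes F)=(F\otimes m_B)\circ(\psi\otimes B)\circ(B\otimes\psi)$, $\psi\circ(\eta_B\otimes F)=F\otimes\eta_B$; $(F\otimes m_B)\circ(\mu_M\otimes B)\circ(F\otimes\psi)\circ(\psi\otimes F)=(F\otimes m_B)\circ(\psi\otimes B)\circ(B\otimes\mu_M)$; $(F\otimes m_B)\circ(\eta_M\otimes B)=(F\otimes m_B)\circ(\psi\otimes B)\circ(B\otimes\eta_M)$; $(F\otimes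 m_B)\circ(\mu_M\otimes B)\circ(F\otimes\mu_M)=(F\otimes m_B)\circ(\mu_M\otimes B)\circ(F\otimes\psi)\circ(\mu_M\otimes F)$; $(F\otimes m_B)\circ(\mu_M\otimes B)\circ(F\otimes\psi)\circ(\eta_M\otimes F)=F\otimes\eta_B=(F\otimes m_B)\circ(\mu_M\otimes B)\circ(F\otimes\eta_M)$. RIGHT COWREATH. For a comonad $F$, $(B,\phi':FB\to BF,\Delta'_C:FB\to BB,\varepsilon'_C:FB\to 1)$ is a right cowreath around $F$ if $(\phi'\otimes F)\circ(F\otimes\phi')\circ(\Delta_F\otimes B)=(B\otimes\Delta_F)\circ\phi'$, $(B\otimes\varepsilon_F)\circ\phi'=\varepsilon_F\otimes B$; $(\Delta'_C\otimes F)\circ(F\otimes\phi')\circ(\Delta_F\otimes B)=(B\otimes\phi')\circ(\phi'\otimes B)\circ(F\otimes\Delta'_C)\circ(\Delta_F\otimes B)$; $(\varepsilon'_C\otimes F)\circ(F\otimes\phi')\circ(\Delta_F\otimes B)=(F\otimes\varepsilon'_C)\circ(\Delta_F\otimes B)$; $(B\otimes\Delta'_C)\circ(\phi'\otimes B)\circ(F\otimes\Delta'_C)\circ(\Delta_F\otimes B)=(\Delta'_C\otimes B)\circ(F\otimes\Delta'_C)\circ(\Delta_F\otimes B)$; $(B\otimes\varepsilon'_C)\circ(\phi'\otimes B)\circ(F\otimes\Delta'_C)\circ(\Delta_F\otimes B)=\varepsilon_F\otimes B=(\varepsilon'_C\otimes B)\circ(F\otimes\Delta'_C)\circ(\Delta_F\otimes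 B)$. AUXILIARY 2-CELLS. Given $m_B,\eta_B,\Delta_B,\varepsilon_B,m_F,\eta_F,\Delta_F,\varepsilon_F$, 2-cells $l:BF\to F$, $r:BF\to B$, $c:B\to BF$, $d:F\to BF$, $\sigma:FF\to B$, $\rho':F\to BB$, $\tau_{X,Y}:XY\to YX$ ($X,Y\in\{B,F\}$), and $\psi,\phi'$, put $P_B=(BB\otimes m_B)\circ(BB\otimes m_B\otimes B)\circ(BB\otimes\sigma\otimes BB)\circ(B\otimes\tau_{F,B}\otimes\psi\otimes B)\circ(c\otimes\tau_{B,B}\otimes FB)\circ(BB\otimes c\otimes B)\circ(\Delta_B\otimes\Delta_B):BB\to BBB$; $P_F=(m_F\otimes m_F)\circ(F\otimes l\otimes F\otimes l)\circ(FB\otimes\tau_{F,F}\otimes BF)\circ(F\otimes\phi'\otimes\tau_{B,F}\otimes F)\circ(FF\otimes\rho'\otimes FF)\circ(F\otimes\Delta_F\otimes FF)\circ(\Delta_F\otimes FF):FFF\to FF$; $Q_B=(m_B\otimes m_B)\circ(BB\otimes r\otimes B)\circ(B\otimes\tau_{B,B}\otimes FB)\circ(BB\otimes c\otimes B)\circ(\Delta_B\otimes\Delta_B):BB\to BB$; $Q_F=(m_F\otimes m_F)\circ(F\otimes l\otimes FF)\circ(FB\otimes\tau_{F,F}\otimes F)\circ(F\otimes d\otimes FF)\circ(\Delta_F\otimes\Delta_F):FF\to FF$. PAIRED WREATH. A paired wreath $(B,F)$ consists of: (1) a monad $(B,m_B,\eta_B)$ with a 2-cell $\varepsilon_B:B\to1$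 and a comonad $(F,\Delta_F,\varepsilon_F)$ with a 2-cell $\eta_F:1\to F$ satisfying $\varepsilon_B\circ m_B=\varepsilon_B\otimes\varepsilon_B$, $\varepsilon_B\circ\eta_B=\mathrm{id}_1$, $\Delta_F\circ\eta_F=\eta_F\otimes\eta_F$, $\varepsilon_F\circ\eta_F=\mathrm{id}_1$; (2) a left wreath $(F,\psi,\mu_M,\eta_M)$ around $B$ and a right cowreath $(B,\phi',\Delta'_C,\varepsilon'_C)$ around $F$, with $\eta_F=(F\otimes\varepsilon_B)\circ\eta_M$ and $\varepsilon_B=\varepsilon'_C\circ(\eta_F\otimes B)$; one puts $m_F:=(F\otimes\varepsilon_B)\circ\mu_M$, $\Delta_B:=\Delta'_C\circ(\eta_F\otimes B)$, $l:=(F\otimes\varepsilon_B)\circ\psi$, $r:=(\varepsilon_F\otimes B)\circ\psi$, $c:=\phi'\circ(\eta_F\otimes B)$, $d:=\phi'\circ(F\otimes\eta_B)$, $\sigma:=(\varepsilon_F\otimes B)\circ\mu_M$, $\rho':=\Delta'_C\circ(F\otimes\eta_B)$; (3) $\Delta_B\circ\eta_B=\eta_B\otimes\eta_B$ and $\varepsilon_F\circ m_F=\varepsilon_F\otimes\varepsilon_F$; (4) $(\varepsilon_F\otimes\varepsilon_B)\circ\psi=\varepsilon_B\otimes\varepsilon_F$, $\phi'\circ(\eta_F\otimes\eta_B)=\eta_B\otimes\eta_F$, and $\psi=(l\otimes r)\circ(B\otimes\tau_{B,F}\otimes F)\circ(\Delta_B\otimes\Delta_F)$, $\phi'=(m_B\otimes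 m_F)\circ(B\otimes\tau_{F,B}\otimes F)\circ(d\otimes c)$, where $\tau_{X,Y}:XY\to YX$ ($X,Y\in\{B,F\}$) are given left and right monadic and comonadic distributive laws with respect to the 2-cells $m_B,\eta_B,\Delta_B,\varepsilon_B$ on $B$ and $m_F,\eta_F,\Delta_F,\varepsilon_F$ on $F$; (5) 2-cells $\lambda_B:BB\to BB$, $\lambda_F:FF\to FF$ with $(B\otimes\lambda_B)\circ(\Delta_B\otimes B)=P_B$, $(F\otimes m_F)\circ(\lambda_F\otimes F)=P_F$, $\mu_M=(F\otimes\sigma)\circ(\lambda_F\otimes F)\circ(F\otimes\Delta_F)$, $\Delta'_C=(m_B\otimes B)\circ(B\otimes\lambda_B)\circ(\rho'\otimes B)$; (6) $FB$ is a $\tau$-bimonad with $\nabla_{FB}=(F\otimes m_B)\circ(\mu_M\otimes m_B)\circ(F\otimes\psi\otimes B)$, $\eta_{FB}=\eta_M$, $\Delta_{FB}=(F\otimes\phi'\otimes B)\circ(\Delta_F\otimes\Delta'_C)\circ(\Delta_F\otimes B)$, $\varepsilon_{FB}=\varepsilon'_C$, $\tau_{FB,FB}=(F\otimes\tau_{F,B}\otimes B)\circ(\tau_{F,F}\otimes\tau_{B,B})\circ(F\otimes\tau_{B,F}\otimes B)$. $\eta_M$ and $\varepsilon'_C$ are called canonical if $\eta_M=\eta_F\otimes\eta_B$, $\varepsilon'_C=\varepsilon_F\otimes\varepsilon_B$. HOPF DATUM. A Hopf datum $(B,F)$ consists of: (1) a monad $(B,m_B,\eta_B)$ and a comonad $(F,\Delta_F,\varepsilon_F)$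 over $\mathcal A$, with further 2-cells $\Delta_B:B\to BB$, $\varepsilon_B:B\to1$, $m_F:FF\to F$, $\eta_F:1\to F$, such that for $X=B,F$: $\varepsilon_X\circ m_X=\varepsilon_X\otimes\varepsilon_X$, $\Delta_X\circ\eta_X=\eta_X\otimes\eta_X$, $\varepsilon_X\circ\eta_X=\mathrm{id}_1$; (2) 2-cells $l:BF\to F$, $c:B\to BF$, $r:BF\to B$, $d:F\to BF$ such that $l$ makes $F$ a left $B$-module, $c$ makes $B$ a right $F$-comodule, and $\varepsilon_F\circ l=\varepsilon_B\otimes\varepsilon_F$, $c\circ\eta_B=\eta_B\otimes\eta_F$, $\varepsilon_B\circ r=\varepsilon_B\otimes\varepsilon_F$, $d\circ\eta_F=\eta_B\otimes\eta_F$; (3) 2-cells $\sigma:FF\to B$, $\rho':F\to BB$ and left and right monadic and comonadic distributive laws $\tau_{X,Y}:XY\to YX$, $X,Y\in\{B,F\}$ (with respect to the 2-cells in (1)); (4) such that, setting $\eta_M=\eta_F\otimes\eta_B$, $\varepsilon'_C=\varepsilon_F\otimes\varepsilon_B$, $\psi=(l\otimes r)\circ(B\otimes\tau_{B,F}\otimes F)\circ(\Delta_B\otimes\Delta_F)$, $\phi'=(m_B\otimes m_F)\circ(B\otimes\tau_{F,B}\otimes F)\circ(d\otimes c)$, $\mu_M=(m_F\otimes\sigma)\circ(F\otimes l\otimes FF)\circ(FB\otimes\tau_{F,F}\otimes F)\circ(F\otimes d\otimes FF)\circ(\Delta_F\otimes\Delta_F)$, $\Delta'_C=(m_B\otimes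 m_B)\circ(BB\otimes r\otimes B)\circ(B\otimes\tau_{B,B}\otimes FB)\circ(BB\otimes c\otimes B)\circ(\rho'\otimes\Delta_B)$, the following hold: (a) $m_F\circ(F\otimes l)\circ(\psi\otimes F)=l\circ(B\otimes m_F)$, $l\circ(B\otimes\eta_F)=\eta_F\circ\varepsilon_B$; (b) $(B\otimes\phi')\circ(c\otimes B)\circ\Delta_B=(\Delta_B\otimes F)\circ c$, $(\varepsilon_B\otimes F)\circ c=\eta_F\circ\varepsilon_B$; (c) $m_F\circ(F\otimes m_F)=m_F\circ(F\otimes l)\circ(\mu_M\otimes F)$, $m_F\circ(F\otimes l)\circ(\eta_M\otimes F)=F=m_F\circ(F\otimes\eta_F)$; (d) $(\Delta_B\otimes B)\circ\Delta_B=(B\otimes\Delta'_C)\circ(c\otimes B)\circ\Delta_B$, $(B\otimes\varepsilon'_C)\circ(c\otimes B)\circ\Delta_B=B=(\varepsilon_B\otimes B)\circ\Delta_B$; (e) $m_B\circ(r\otimes B)\circ(B\otimes\psi)=r\circ(m_B\otimes F)$, $r\circ(\eta_B\otimes F)=\eta_B\circ\varepsilon_F$; (f) $(\phi'\otimes F)\circ(F\otimes d)\circ\Delta_F=(B\otimes\Delta_F)\circ d$, $(B\otimes\varepsilon_F)\circ d=\eta_B\circ\varepsilon_F$; (g) $m_B\circ(\sigma\otimes B)\circ(F\otimes\psi)\circ(\psi\otimes F)=m_B\circ(r\otimes B)\circ(B\otimes\mu_M)$, $m_B\circ(\varepsilon_F\otimes BB)\circ(\eta_M\otimes B)=m_B\circ(r\otimes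 B)\circ(B\otimes\eta_M)$; (h) $(\Delta'_C\otimes F)\circ(F\otimes d)\circ\Delta_F=(B\otimes\phi')\circ(\phi'\otimes B)\circ(F\otimes\rho')\circ\Delta_F$, $(\varepsilon'_C\otimes F)\circ(F\otimes d)\circ\Delta_F=(F\otimes\varepsilon'_C)\circ(\Delta_F\otimes\eta_B)$; (i) $m_B\circ(\sigma\otimes B)\circ(F\otimes\mu_M)=m_B\circ(\sigma\otimes B)\circ(F\otimes\psi)\circ(\mu_M\otimes F)$, $m_B\circ(\sigma\otimes B)\circ(F\otimes\psi)\circ(\eta_M\otimes F)=\eta_B\circ\varepsilon_F=m_B\circ(\sigma\otimes B)\circ(F\otimes\eta_M)$; (j) $(B\otimes\Delta'_C)\circ(\phi'\otimes B)\circ(F\otimes\rho')\circ\Delta_F=(\Delta'_C\otimes B)\circ(F\otimes\rho')\circ\Delta_F$, $(B\otimes\varepsilon'_C)\circ(\phi'\otimes B)\circ(F\otimes\rho')\circ\Delta_F=\eta_B\circ\varepsilon_F=(\varepsilon'_C\otimes B)\circ(F\otimes\rho')\circ\Delta_F$; (k) $\varepsilon_B\circ\sigma=\varepsilon_F\otimes\varepsilon_F$, $\rho'\circ\eta_F=\eta_B\otimes\eta_B$; (l1) $\phi'\circ\psi=(m_B\otimes m_F)\circ(r\otimes\tau_{F,B}\otimes l)\circ(B\otimes\tau_{F,F}\otimes\tau_{B,B}\otimes F)\circ(c\otimes\tau_{B,F}\otimes d)\circ(\Delta_B\otimes\Delta_F)$; (l2) $\Delta'_C\circ\psi=(B\otimes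 m_B)\circ(m_B\otimes\sigma\otimes m_B)\circ(r\otimes\tau_{F,B}\otimes\psi\otimes B)\circ(B\otimes\tau_{F,F}\otimes\tau_{B,B}\otimes FB)\circ(c\otimes\tau_{B,F}\otimes\phi'\otimes B)\circ(BB\otimes\Delta_F\otimes\rho')\circ(\Delta_B\otimes\Delta_F)$; (l3) $\Delta_F\circ l=(l\otimes m_F)\circ(B\otimes\tau_{F,F}\otimes l)\circ(c\otimes\tau_{B,F}\otimes F)\circ(\Delta_B\otimes\Delta_F)$; (l4) $\phi'\circ\mu_M=(m_B\otimes F)\circ(\sigma\otimes m_B\otimes m_F)\circ(F\otimes\psi\otimes\tau_{F,B}\otimes l)\circ(FB\otimes\tau_{F,F}\otimes\tau_{B,B}\otimes F)\circ(F\otimes\phi'\otimes\tau_{B,F}\otimes d)\circ(\Delta_F\otimes\rho'\otimes\Delta_F)\circ(\Delta_F\otimes F)$; (l5) $\Delta'_C\circ\mu_M=(m_B\otimes m_B)\circ(\sigma\otimes m_B\otimes\sigma\otimes m_B)\circ(F\otimes\psi\otimes\tau_{F,B}\otimes\psi\otimes B)\circ(FB\otimes\tau_{F,F}\otimes\tau_{B,B}\otimes FB)\circ(F\otimes\phi'\otimes\tau_{B,F}\otimes\phi'\otimes B)\circ(\Delta_F\otimes\rho'\otimes\Delta_F\otimes\rho')\circ(\Delta_F\otimes\Delta_F)$; (l6) $c\circ m_B=(m_B\otimes m_F)\circ(B\otimes\tau_{F,B}\otimes l)\circ(c\otimes\tau_{B,B}\otimes F)\circ(\Delta_B\otimes c)$;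 (m) $\Delta_B\circ m_B=(m_B\otimes B)\circ P_B=Q_B$ and $\Delta_F\circ m_F=P_F\circ(F\otimes\Delta_F)=Q_F$. *)

(* Defs.v *)
From mathcomp Require Import all_boot.

Set Implicit Arguments.
Unset Strict Implicit.
Unset Printing Implicit Defensive.

(* Strict 2-categories *)

Definition cast2 (T : Type) (H : T -> T -> Type) (x x' y y' : T)
    (ex : x = x') (ey : y = y') (u : H x y) : H x' y' :=
  match ex in _ = z, ey in _ = t return H z t with
  | erefl, erefl => u
  end.

(* Strictness: 1-cells compose associatively and unitally on the nose, and
   the corresponding laws for horizontal composition of 2-cells are stated by
   transport along these equalities of 1-cells.
   [comp1 X Y] is the composite XY (first Y, then X); [vcomp g f] is g o f;
   [hcomp u v] is the horizontal composite with the letters in the order of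
   [comp1]. *)
Record twoCategory := TwoCategory {
  ob :> Type;
  hom1 : ob -> ob -> Type;
  hom2 : forall a b : ob, hom1 a b -> hom1 a b -> Type;
  id1 : forall a : ob, hom1 a a;
  comp1 : forall a b c : ob, hom1 b c -> hom1 a b -> hom1 a c;
  id2 : forall (a b : ob) (X : hom1 a b), hom2 X X;
  vcomp : forall (a b : ob) (X Y Z : hom1 a b),
    hom2 Y Z -> hom2 X Y -> hom2 X Z;
  hcomp : forall (a b c : ob) (X X' : hom1 b c) (Y Y' : hom1 a b),
    hom2 X X' -> hom2 Y Y' -> hom2 (comp1 X Y) (comp1 X' Y');
  vcompA : forall (a b : ob) (X Y Z T : hom1 a b)
      (h : hom2 Z T) (g : hom2 Y Z) (f : hom2 X Y),
    vcomp h (vcomp g f) = vcomp (vcomp h g) f;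
  vcomp1l : forall (a b : ob) (X Y : hom1 a b) (f : hom2 X Y),
    vcomp (id2 Y) f = f;
  vcomp1r : forall (a b : ob) (X Y : hom1 a b) (f : hom2 X Y),
    vcomp f (id2 X) = f;
  hcomp_id2 : forall (a b c : ob) (X : hom1 b c) (Y : hom1 a b),
    hcomp (id2 X) (id2 Y) = id2 (comp1 X Y);
  interchange : forall (a b c : ob) (X X' X'' : hom1 b c)
      (Y Y' Y'' : hom1 a b) (g : hom2 X' X'') (f : hom2 X X')
      (k : hom2 Y' Y'') (h : hom2 Y Y'),
    hcomp (vcomp g f) (vcomp k h) = vcomp (hcomp g k) (hcomp f h);
  comp1A : forall (a b c d : ob) (X : hom1 c d) (Y : hom1 b c) (Z : hom1 a b),
    comp1 X (comp1 Y Z) = comp1 (comp1 X Y) Z;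
  comp1_1l : forall (a b : ob) (X : hom1 a b), comp1 (id1 b) X = X;
  comp1_1r : forall (a b : ob) (X : hom1 a b), comp1 X (id1 a) = X;
  hcompA : forall (a b c d : ob) (X X' : hom1 c d) (Y Y' : hom1 b c)
      (Z Z' : hom1 a b) (u : hom2 X X') (v : hom2 Y Y') (w : hom2 Z Z'),
    cast2 (comp1A X Y Z) (comp1A X' Y' Z') (hcomp u (hcomp v w))
    = hcomp (hcomp u v) w;
  hcomp1l : forall (a b : ob) (X X' : hom1 a b) (u : hom2 X X'),
    cast2 (comp1_1l X) (comp1_1l X') (hcomp (id2 (id1 b)) u) = u;
  hcomp1r : forall (a b : ob) (X X' : hom1 a b) (u : hom2 X X'),
    cast2 (comp1_1r X) (comp1_1r X') (hcomp u (id2 (id1 a))) = u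
}.

Arguments id1 {_} _.
Arguments id2 {_ _ _} _.
Arguments hom2 {_ _ _} _ _.

(* The strict monoidal category K(A, A) *)

(* A [word] [:: X; Y; ...] stands for the composite 1-cell XY... .  2-cells go
   between composites of sequences of words; such a sequence is flattened
   before being composed.  Thus [cell [:: [:: F; B]; [:: F; B]] t] and
   [cell [:: [:: F]; [:: B]; [:: F]; [:: B]] t] are convertible, both being
   2-cells out of FBFB: a general notion stated for a word X can be applied
   directly to X = FB, and no associativity transport appears in equations. *)
Definition endo1 (K : twoCategory) (A : K) : Type := hom1 A A.
Definition word (K : twoCategory) (A : K) : Type := seq (endo1 A).
Definition letter (K : twoCategory) (A : K) (X : endo1 A) : word A := [:: X].
Coercion letter : endo1 >-> word.

Notation "[w X ; .. ; Y ]" :=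
  (@cons (word _) X .. (@cons (word _) Y (@nil (word _))) ..)
  (at level 0, format "[w X ;  .. ;  Y ]").

Fixpoint wprod (K : twoCategory) (A : K) (s : seq (endo1 A)) : endo1 A :=
  match s with
  | [::] => id1 A
  | [:: X] => X
  | X :: s' => comp1 X (wprod s')
  end.

Lemma wprod_cat (K : twoCategory) (A : K) (s t : seq (endo1 A)) :
  comp1 (wprod s) (wprod t) = wprod (s ++ t).
Proof.
elim: s => [|X s IHs]; first exact: comp1_1l.
case: s IHs => [|Y s] IHs.
  by case: t {IHs} => [|Z t] //=; exact: comp1_1r.
by rewrite /= -comp1A; congr (comp1 _ _); exact: IHs.
Qed.

Definition hprod (K : twoCategory) (A : K) (s : seq (word A)) : endo1 A :=
  wprod (flatten s).

Lemma hprod_cat (K : twoCategory) (A : K) (s t : seq (word A)) :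
  comp1 (hprod s) (hprod t) = hprod (s ++ t).
Proof. by rewrite /hprod flatten_cat wprod_cat. Qed.

Definition cell (K : twoCategory) (A : K) (s t : seq (word A)) : Type :=
  hom2 (hprod s) (hprod t).

(* As a coercion, this lets a 1-cell denote its identity 2-cell. *)
Definition idw (K : twoCategory) (A : K) (X : word A) : cell [:: X] [:: X] :=
  id2 (hprod [:: X]).
Coercion idw : word >-> cell.

Definition id_unit (K : twoCategory) (A : K) : @cell K A [::] [::] :=
  id2 (id1 A).

Definition vert (K : twoCategory) (A : K) (s t u : seq (word A))
    (g : cell t u) (f : cell s t) : cell s u :=
  vcomp g f.

Definition tens (K : twoCategory) (A : K) (s s' t t' : seq (word A))
    (f : cell s s') (g : cell t t') : cell (s ++ t) (s' ++ t') :=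
  cast2 (hprod_cat s t) (hprod_cat s' t') (hcomp f g).

Declare Scope cell_scope.
Delimit Scope cell_scope with cell.
Bind Scope cell_scope with cell.
Notation "f ⊗ g" := (tens f g) (at level 35, right associativity) : cell_scope.
Notation "g ∘ f" := (vert g f) (at level 45, right associativity) : cell_scope.
Local Open Scope cell_scope.

(* Monads, comonads, distributive laws, bimonads *)

Definition is_monad (K : twoCategory) (A : K) (X : word A)
    (m : cell [:: X; X] [:: X]) (eta : cell [::] [:: X]) : Prop :=
  [/\ m ∘ (m ⊗ X) = m ∘ (X ⊗ m),
      m ∘ (eta ⊗ X) = X
    & m ∘ (X ⊗ eta) = X].

Definition is_comonad (K : twoCategory) (A : K) (X : word A)
    (Delta : cell [:: X] [:: X; X]) (eps : cell [:: X] [::]) : Prop :=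
  [/\ (Delta ⊗ X) ∘ Delta = (X ⊗ Delta) ∘ Delta,
      (eps ⊗ X) ∘ Delta = X
    & (X ⊗ eps) ∘ Delta = X].

(* Four structure 2-cells on X, with no axioms. *)
Record ops (K : twoCategory) (A : K) (X : word A) := Ops {
  op_m : cell [:: X; X] [:: X];
  op_eta : cell [::] [:: X];
  op_Delta : cell [:: X] [:: X; X];
  op_eps : cell [:: X] [::]
}.

(* Left and right monadic and comonadic distributive law. *)
Record is_distributive_law (K : twoCategory) (A : K) (X Y : word A)
    (oX : ops X) (oY : ops Y) (tau : cell [:: X; Y] [:: Y; X]) : Prop := {
  dl_mX : tau ∘ (op_m oX ⊗ Y) = (Y ⊗ op_m oX) ∘ (tau ⊗ X) ∘ (X ⊗ tau);
  dl_etaX : tau ∘ (op_eta oX ⊗ Y) = Y ⊗ op_eta oX;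
  dl_mY : tau ∘ (X ⊗ op_m oY) = (op_m oY ⊗ X) ∘ (Y ⊗ tau) ∘ (tau ⊗ Y);
  dl_etaY : tau ∘ (X ⊗ op_eta oY) = op_eta oY ⊗ X;
  dl_DeltaY :
    (Y ⊗ tau) ∘ (tau ⊗ Y) ∘ (X ⊗ op_Delta oY) = (op_Delta oY ⊗ X) ∘ tau;
  dl_epsY : (op_eps oY ⊗ X) ∘ tau = X ⊗ op_eps oY;
  dl_DeltaX :
    (tau ⊗ X) ∘ (X ⊗ tau) ∘ (op_Delta oX ⊗ Y) = (Y ⊗ op_Delta oX) ∘ tau;
  dl_epsX : (Y ⊗ op_eps oX) ∘ tau = op_eps oX ⊗ Y
}.

Record is_tau_bimonad (K : twoCategory) (A : K) (X : word A)
    (oX : ops X) (tau : cell [:: X; X] [:: X; X]) : Prop := {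
  bim_monad : is_monad (op_m oX) (op_eta oX);
  bim_comonad : is_comonad (op_Delta oX) (op_eps oX);
  bim_tau : is_distributive_law oX oX tau;
  bim_eps_m : op_eps oX ∘ op_m oX = op_eps oX ⊗ op_eps oX;
  bim_Delta_eta : op_Delta oX ∘ op_eta oX = op_eta oX ⊗ op_eta oX;
  bim_eps_eta : op_eps oX ∘ op_eta oX = id_unit A;
  bim_Delta_m : op_Delta oX ∘ op_m oX
    = (op_m oX ⊗ op_m oX) ∘ (X ⊗ tau ⊗ X) ∘ (op_Delta oX ⊗ op_Delta oX)
}.

(* Wreaths and cowreaths *)

Record is_left_wreath (K : twoCategory) (A : K) (B F : endo1 A)
    (mB : cell [w B; B] [w B])
    (etaB : cell [::] [w B])
    (psi : cell [w B; F] [w F; B])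
    (muM : cell [w F; F] [w F; B])
    (etaM : cell [::] [w F; B]) : Prop := {
  lw_psi_m : psi ∘ (mB ⊗ F) = (F ⊗ mB) ∘ (psi ⊗ B) ∘ (B ⊗ psi);
  lw_psi_eta : psi ∘ (etaB ⊗ F) = F ⊗ etaB;
  lw_muM_psi :
    (F ⊗ mB) ∘ (muM ⊗ B) ∘ (F ⊗ psi) ∘ (psi ⊗ F)
    = (F ⊗ mB) ∘ (psi ⊗ B) ∘ (B ⊗ muM);
  lw_etaM_psi : (F ⊗ mB) ∘ (etaM ⊗ B) = (F ⊗ mB) ∘ (psi ⊗ B) ∘ (B ⊗ etaM);
  lw_muM_assoc :
    (F ⊗ mB) ∘ (muM ⊗ B) ∘ (F ⊗ muM)
    = (F ⊗ mB) ∘ (muM ⊗ B) ∘ (F ⊗ psi) ∘ (muM ⊗ F);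
  lw_muM_unitl :
    (F ⊗ mB) ∘ (muM ⊗ B) ∘ (F ⊗ psi) ∘ (etaM ⊗ F) = F ⊗ etaB;
  lw_muM_unitr : F ⊗ etaB = (F ⊗ mB) ∘ (muM ⊗ B) ∘ (F ⊗ etaM)
}.

Record is_right_cowreath (K : twoCategory) (A : K) (F B : endo1 A)
    (DeltaF : cell [w F] [w F; F])
    (epsF : cell [w F] [::])
    (phi' : cell [w F; B] [w B; F])
    (DeltaC : cell [w F; B] [w B; B])
    (epsC : cell [w F; B] [::]) : Prop := {
  rc_phi_Delta :
    (phi' ⊗ F) ∘ (F ⊗ phi') ∘ (DeltaF ⊗ B) = (B ⊗ DeltaF) ∘ phi';
  rc_phi_eps : (B ⊗ epsF) ∘ phi' = epsF ⊗ B;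
  rc_DeltaC_phi :
    (DeltaC ⊗ F) ∘ (F ⊗ phi') ∘ (DeltaF ⊗ B)
    = (B ⊗ phi') ∘ (phi' ⊗ B) ∘ (F ⊗ DeltaC) ∘ (DeltaF ⊗ B);
  rc_epsC_phi :
    (epsC ⊗ F) ∘ (F ⊗ phi') ∘ (DeltaF ⊗ B) = (F ⊗ epsC) ∘ (DeltaF ⊗ B);
  rc_DeltaC_coassoc :
    (B ⊗ DeltaC) ∘ (phi' ⊗ B) ∘ (F ⊗ DeltaC) ∘ (DeltaF ⊗ B)
    = (DeltaC ⊗ B) ∘ (F ⊗ DeltaC) ∘ (DeltaF ⊗ B);
  rc_DeltaC_counitr :
    (B ⊗ epsC) ∘ (phi' ⊗ B) ∘ (F ⊗ DeltaC) ∘ (DeltaF ⊗ B) = epsF ⊗ B;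
  rc_DeltaC_counitl :
    epsF ⊗ B = (epsC ⊗ B) ∘ (F ⊗ DeltaC) ∘ (DeltaF ⊗ B)
}.

(* Hopf data *)

Record hopf_data (K : twoCategory) (A : K) := HopfData {
  hd_B : endo1 A;
  hd_F : endo1 A;
  hd_opsB : ops hd_B;
  hd_opsF : ops hd_F;
  hd_l : cell [w hd_B; hd_F] [w hd_F];
  hd_r : cell [w hd_B; hd_F] [w hd_B];
  hd_c : cell [w hd_B] [w hd_B; hd_F];
  hd_d : cell [w hd_F] [w hd_B; hd_F];
  hd_sigma : cell [w hd_F; hd_F] [w hd_B];
  hd_rho' : cell [w hd_F] [w hd_B; hd_B];
  hd_tauBB : cell [w hd_B; hd_B] [w hd_B; hd_B];
  hd_tauBF : cell [w hd_B; hd_F] [w hd_F; hd_B];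
  hd_tauFB : cell [w hd_F; hd_B] [w hd_B; hd_F];
  hd_tauFF : cell [w hd_F; hd_F] [w hd_F; hd_F]
}.

Section HopfDatum.

Context (K : twoCategory) (A : K) (D : hopf_data A).

Local Notation B := (hd_B D).
Local Notation F := (hd_F D).
Local Notation mB := (op_m (hd_opsB D)).
Local Notation etaB := (op_eta (hd_opsB D)).
Local Notation DeltaB := (op_Delta (hd_opsB D)).
Local Notation epsB := (op_eps (hd_opsB D)).
Local Notation mF := (op_m (hd_opsF D)).
Local Notation etaF := (op_eta (hd_opsF D)).
Local Notation DeltaF := (op_Delta (hd_opsF D)).
Local Notation epsF := (op_eps (hd_opsF D)).
Local Notation l := (hd_l D).
Local Notation r := (hd_r D).
Local Notation c := (hd_c D).
Local Notation d := (hd_d D).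
Local Notation sigma := (hd_sigma D).
Local Notation rho' := (hd_rho' D).
Local Notation tauBB := (hd_tauBB D).
Local Notation tauBF := (hd_tauBF D).
Local Notation tauFB := (hd_tauFB D).
Local Notation tauFF := (hd_tauFF D).

(* The auxiliary 2-cells P_B, P_F, Q_B and Q_F, for arbitrary psi and phi'. *)

Definition hd_PB (psi : cell [w B; F] [w F; B]) :
    cell [w B; B] [w B; B; B] :=
  (B ⊗ B ⊗ mB) ∘ (B ⊗ B ⊗ mB ⊗ B) ∘ (B ⊗ B ⊗ sigma ⊗ B ⊗ B)
  ∘ (B ⊗ tauFB ⊗ psi ⊗ B) ∘ (c ⊗ tauBB ⊗ F ⊗ B) ∘ (B ⊗ B ⊗ c ⊗ B)
  ∘ (DeltaB ⊗ DeltaB).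

Definition hd_PF (phi' : cell [w F; B] [w B; F]) :
    cell [w F; F; F] [w F; F] :=
  (mF ⊗ mF) ∘ (F ⊗ l ⊗ F ⊗ l) ∘ (F ⊗ B ⊗ tauFF ⊗ B ⊗ F)
  ∘ (F ⊗ phi' ⊗ tauBF ⊗ F) ∘ (F ⊗ F ⊗ rho' ⊗ F ⊗ F)
  ∘ (F ⊗ DeltaF ⊗ F ⊗ F) ∘ (DeltaF ⊗ F ⊗ F).

Definition hd_QB : cell [w B; B] [w B; B] :=
  (mB ⊗ mB) ∘ (B ⊗ B ⊗ r ⊗ B) ∘ (B ⊗ tauBB ⊗ F ⊗ B) ∘ (B ⊗ B ⊗ c ⊗ B)
  ∘ (DeltaB ⊗ DeltaB).

Definition hd_QF : cell [w F; F] [w F; F] :=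
  (mF ⊗ mF) ∘ (F ⊗ l ⊗ F ⊗ F) ∘ (F ⊗ B ⊗ tauFF ⊗ F) ∘ (F ⊗ d ⊗ F ⊗ F)
  ∘ (DeltaF ⊗ DeltaF).

(* The 2-cells associated with a Hopf datum. *)

Definition hd_etaM : cell [::] [w F; B] := etaF ⊗ etaB.

Definition hd_epsC : cell [w F; B] [::] := epsF ⊗ epsB.

Definition hd_psi : cell [w B; F] [w F; B] :=
  (l ⊗ r) ∘ (B ⊗ tauBF ⊗ F) ∘ (DeltaB ⊗ DeltaF).

Definition hd_phi' : cell [w F; B] [w B; F] :=
  (mB ⊗ mF) ∘ (B ⊗ tauFB ⊗ F) ∘ (d ⊗ c).

Definition hd_muM : cell [w F; F] [w F; B] :=
  (mF ⊗ sigma) ∘ (F ⊗ l ⊗ F ⊗ F) ∘ (F ⊗ B ⊗ tauFF ⊗ F) ∘ (F ⊗ d ⊗ F ⊗ F)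
  ∘ (DeltaF ⊗ DeltaF).

Definition hd_DeltaC : cell [w F; B] [w B; B] :=
  (mB ⊗ mB) ∘ (B ⊗ B ⊗ r ⊗ B) ∘ (B ⊗ tauBB ⊗ F ⊗ B) ∘ (B ⊗ B ⊗ c ⊗ B)
  ∘ (rho' ⊗ DeltaB).

Record are_distributive_laws : Prop := {
  tauBB_law : is_distributive_law (hd_opsB D) (hd_opsB D) tauBB;
  tauBF_law : is_distributive_law (hd_opsB D) (hd_opsF D) tauBF;
  tauFB_law : is_distributive_law (hd_opsF D) (hd_opsB D) tauFB;
  tauFF_law : is_distributive_law (hd_opsF D) (hd_opsF D) tauFF
}.

Local Notation psi := hd_psi.
Local Notation phi' := hd_phi'.
Local Notation muM := hd_muM.
Local Notation DeltaC := hd_DeltaC.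
Local Notation etaM := hd_etaM.
Local Notation epsC := hd_epsC.

Record is_hopf_datum : Prop := {
  hd_monadB : is_monad mB etaB;
  hd_comonadF : is_comonad DeltaF epsF;
  hd_epsB_mB : epsB ∘ mB = epsB ⊗ epsB;
  hd_DeltaB_etaB : DeltaB ∘ etaB = etaB ⊗ etaB;
  hd_epsB_etaB : epsB ∘ etaB = id_unit A;
  hd_epsF_mF : epsF ∘ mF = epsF ⊗ epsF;
  hd_DeltaF_etaF : DeltaF ∘ etaF = etaF ⊗ etaF;
  hd_epsF_etaF : epsF ∘ etaF = id_unit A;

  hd_l_module : l ∘ (mB ⊗ F) = l ∘ (B ⊗ l);
  hd_l_unit : l ∘ (etaB ⊗ F) = F;
  hd_c_comodule : (B ⊗ DeltaF) ∘ c = (c ⊗ F) ∘ c;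
  hd_c_counit : (B ⊗ epsF) ∘ c = B;
  hd_epsF_l : epsF ∘ l = epsB ⊗ epsF;
  hd_c_etaB : c ∘ etaB = etaB ⊗ etaF;
  hd_epsB_r : epsB ∘ r = epsB ⊗ epsF;
  hd_d_etaF : d ∘ etaF = etaB ⊗ etaF;

  hd_tau : are_distributive_laws;

  hd_a1 : mF ∘ (F ⊗ l) ∘ (psi ⊗ F) = l ∘ (B ⊗ mF);
  hd_a2 : l ∘ (B ⊗ etaF) = etaF ∘ epsB;

  hd_b1 : (B ⊗ phi') ∘ (c ⊗ B) ∘ DeltaB = (DeltaB ⊗ F) ∘ c;
  hd_b2 : (epsB ⊗ F) ∘ c = etaF ∘ epsB;

  hd_c1 : mF ∘ (F ⊗ mF) = mF ∘ (F ⊗ l) ∘ (muM ⊗ F);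
  hd_c2 : mF ∘ (F ⊗ l) ∘ (etaM ⊗ F) = F;
  hd_c3 : mF ∘ (F ⊗ etaF) = F;

  hd_d1 : (DeltaB ⊗ B) ∘ DeltaB = (B ⊗ DeltaC) ∘ (c ⊗ B) ∘ DeltaB;
  hd_d2 : (B ⊗ epsC) ∘ (c ⊗ B) ∘ DeltaB = B;
  hd_d3 : (epsB ⊗ B) ∘ DeltaB = B;

  hd_e1 : mB ∘ (r ⊗ B) ∘ (B ⊗ psi) = r ∘ (mB ⊗ F);
  hd_e2 : r ∘ (etaB ⊗ F) = etaB ∘ epsF;

  hd_f1 : (phi' ⊗ F) ∘ (F ⊗ d) ∘ DeltaF = (B ⊗ DeltaF) ∘ d;
  hd_f2 : (B ⊗ epsF) ∘ d = etaB ∘ epsF;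

  hd_g1 : mB ∘ (sigma ⊗ B) ∘ (F ⊗ psi) ∘ (psi ⊗ F)
    = mB ∘ (r ⊗ B) ∘ (B ⊗ muM);
  hd_g2 : mB ∘ (epsF ⊗ B ⊗ B) ∘ (etaM ⊗ B) = mB ∘ (r ⊗ B) ∘ (B ⊗ etaM);

  hd_h1 : (DeltaC ⊗ F) ∘ (F ⊗ d) ∘ DeltaF
    = (B ⊗ phi') ∘ (phi' ⊗ B) ∘ (F ⊗ rho') ∘ DeltaF;
  hd_h2 : (epsC ⊗ F) ∘ (F ⊗ d) ∘ DeltaF = (F ⊗ epsC) ∘ (DeltaF ⊗ etaB);

  hd_i1 : mB ∘ (sigma ⊗ B) ∘ (F ⊗ muM)
    = mB ∘ (sigma ⊗ B) ∘ (F ⊗ psi) ∘ (muM ⊗ F);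
  hd_i2 : mB ∘ (sigma ⊗ B) ∘ (F ⊗ psi) ∘ (etaM ⊗ F) = etaB ∘ epsF;
  hd_i3 : etaB ∘ epsF = mB ∘ (sigma ⊗ B) ∘ (F ⊗ etaM);

  hd_j1 : (B ⊗ DeltaC) ∘ (phi' ⊗ B) ∘ (F ⊗ rho') ∘ DeltaF
    = (DeltaC ⊗ B) ∘ (F ⊗ rho') ∘ DeltaF;
  hd_j2 : (B ⊗ epsC) ∘ (phi' ⊗ B) ∘ (F ⊗ rho') ∘ DeltaF = etaB ∘ epsF;
  hd_j3 : etaB ∘ epsF = (epsC ⊗ B) ∘ (F ⊗ rho') ∘ DeltaF;

  hd_k1 : epsB ∘ sigma = epsF ⊗ epsF;
  hd_k2 : rho' ∘ etaF = etaB ⊗ etaB;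

  hd_l1 : phi' ∘ psi
    = (mB ⊗ mF) ∘ (r ⊗ tauFB ⊗ l) ∘ (B ⊗ tauFF ⊗ tauBB ⊗ F)
      ∘ (c ⊗ tauBF ⊗ d) ∘ (DeltaB ⊗ DeltaF);
  hd_l2 : DeltaC ∘ psi
    = (B ⊗ mB) ∘ (mB ⊗ sigma ⊗ mB) ∘ (r ⊗ tauFB ⊗ psi ⊗ B)
      ∘ (B ⊗ tauFF ⊗ tauBB ⊗ F ⊗ B) ∘ (c ⊗ tauBF ⊗ phi' ⊗ B)
      ∘ (B ⊗ B ⊗ DeltaF ⊗ rho') ∘ (DeltaB ⊗ DeltaF);
  hd_l3 : DeltaF ∘ l
    = (l ⊗ mF) ∘ (B ⊗ tauFF ⊗ l) ∘ (c ⊗ tauBF ⊗ F) ∘ (DeltaB ⊗ DeltaF);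
  hd_l4 : phi' ∘ muM
    = (mB ⊗ F) ∘ (sigma ⊗ mB ⊗ mF) ∘ (F ⊗ psi ⊗ tauFB ⊗ l)
      ∘ (F ⊗ B ⊗ tauFF ⊗ tauBB ⊗ F) ∘ (F ⊗ phi' ⊗ tauBF ⊗ d)
      ∘ (DeltaF ⊗ rho' ⊗ DeltaF) ∘ (DeltaF ⊗ F);
  hd_l5 : DeltaC ∘ muM
    = (mB ⊗ mB) ∘ (sigma ⊗ mB ⊗ sigma ⊗ mB)
      ∘ (F ⊗ psi ⊗ tauFB ⊗ psi ⊗ B)
      ∘ (F ⊗ B ⊗ tauFF ⊗ tauBB ⊗ F ⊗ B)
      ∘ (F ⊗ phi' ⊗ tauBF ⊗ phi' ⊗ B)
      ∘ (DeltaF ⊗ rho' ⊗ DeltaF ⊗ rho') ∘ (DeltaF ⊗ DeltaF);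
  hd_l6 : c ∘ mB
    = (mB ⊗ mF) ∘ (B ⊗ tauFB ⊗ l) ∘ (c ⊗ tauBB ⊗ F) ∘ (DeltaB ⊗ c);

  hd_m1 : DeltaB ∘ mB = (mB ⊗ B) ∘ hd_PB psi;
  hd_m2 : (mB ⊗ B) ∘ hd_PB psi = hd_QB;
  hd_m3 : DeltaF ∘ mF = hd_PF phi' ∘ (F ⊗ DeltaF);
  hd_m4 : hd_PF phi' ∘ (F ⊗ DeltaF) = hd_QF
}.

End HopfDatum.

(* Paired wreaths *)

Record wreath_data (K : twoCategory) (A : K) := WreathData {
  pw_B : endo1 A;
  pw_F : endo1 A;
  pw_mB : cell [w pw_B; pw_B] [w pw_B];
  pw_etaB : cell [::] [w pw_B];
  pw_epsB : cell [w pw_B] [::];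
  pw_DeltaF : cell [w pw_F] [w pw_F; pw_F];
  pw_epsF : cell [w pw_F] [::];
  pw_etaF : cell [::] [w pw_F];
  pw_psi : cell [w pw_B; pw_F] [w pw_F; pw_B];
  pw_muM : cell [w pw_F; pw_F] [w pw_F; pw_B];
  pw_etaM : cell [::] [w pw_F; pw_B];
  pw_phi' : cell [w pw_F; pw_B] [w pw_B; pw_F];
  pw_DeltaC : cell [w pw_F; pw_B] [w pw_B; pw_B];
  pw_epsC : cell [w pw_F; pw_B] [::];
  pw_tauBB : cell [w pw_B; pw_B] [w pw_B; pw_B];
  pw_tauBF : cell [w pw_B; pw_F] [w pw_F; pw_B];
  pw_tauFB : cell [w pw_F; pw_B] [w pw_B; pw_F];
  pw_tauFF : cell [w pw_F; pw_F] [w pw_F; pw_F];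
  pw_lambdaB : cell [w pw_B; pw_B] [w pw_B; pw_B];
  pw_lambdaF : cell [w pw_F; pw_F] [w pw_F; pw_F]
}.

Section PairedWreath.

Context (K : twoCategory) (A : K) (W : wreath_data A).

Local Notation B := (pw_B W).
Local Notation F := (pw_F W).
Local Notation mB := (pw_mB W).
Local Notation etaB := (pw_etaB W).
Local Notation epsB := (pw_epsB W).
Local Notation DeltaF := (pw_DeltaF W).
Local Notation epsF := (pw_epsF W).
Local Notation etaF := (pw_etaF W).
Local Notation psi := (pw_psi W).
Local Notation muM := (pw_muM W).
Local Notation etaM := (pw_etaM W).
Local Notation phi' := (pw_phi' W).
Local Notation DeltaC := (pw_DeltaC W).
Local Notation epsC := (pw_epsC W).
Local Notation tauBB := (pw_tauBB W).
Local Notation tauBF := (pw_tauBF W).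
Local Notation tauFB := (pw_tauFB W).
Local Notation tauFF := (pw_tauFF W).
Local Notation lambdaB := (pw_lambdaB W).
Local Notation lambdaF := (pw_lambdaF W).

Definition pw_mF : cell [w F; F] [w F] := (F ⊗ epsB) ∘ muM.
Definition pw_DeltaB : cell [w B] [w B; B] := DeltaC ∘ (etaF ⊗ B).
Definition pw_l : cell [w B; F] [w F] := (F ⊗ epsB) ∘ psi.
Definition pw_r : cell [w B; F] [w B] := (epsF ⊗ B) ∘ psi.
Definition pw_c : cell [w B] [w B; F] := phi' ∘ (etaF ⊗ B).
Definition pw_d : cell [w F] [w B; F] := phi' ∘ (F ⊗ etaB).
Definition pw_sigma : cell [w F; F] [w B] := (epsF ⊗ B) ∘ muM.
Definition pw_rho' : cell [w F] [w B; B] := DeltaC ∘ (F ⊗ etaB).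

Local Notation mF := pw_mF.
Local Notation DeltaB := pw_DeltaB.
Local Notation l := pw_l.
Local Notation r := pw_r.
Local Notation c := pw_c.
Local Notation d := pw_d.
Local Notation sigma := pw_sigma.
Local Notation rho' := pw_rho'.

Definition hopf_data_of : hopf_data A :=
  @HopfData K A B F (Ops mB etaB DeltaB epsB) (Ops mF etaF DeltaF epsF)
    l r c d sigma rho' tauBB tauBF tauFB tauFF.

Definition pw_FB : word A := [:: F; B].

Definition pw_mFB : cell [w F; B; F; B] [w F; B] :=
  (F ⊗ mB) ∘ (muM ⊗ mB) ∘ (F ⊗ psi ⊗ B).

Definition pw_DeltaFB : cell [w F; B] [w F; B; F; B] :=
  (F ⊗ phi' ⊗ B) ∘ (DeltaF ⊗ DeltaC) ∘ (DeltaF ⊗ B).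

Definition pw_tauFBFB : cell [w F; B; F; B] [w F; B; F; B] :=
  (F ⊗ tauFB ⊗ B) ∘ (tauFF ⊗ tauBB) ∘ (F ⊗ tauBF ⊗ B).

Definition pw_opsFB : ops pw_FB :=
  @Ops K A pw_FB pw_mFB etaM pw_DeltaFB epsC.

Record is_paired_wreath : Prop := {
  pw_monadB : is_monad mB etaB;
  pw_comonadF : is_comonad DeltaF epsF;
  pw_epsB_mB : epsB ∘ mB = epsB ⊗ epsB;
  pw_epsB_etaB : epsB ∘ etaB = id_unit A;
  pw_DeltaF_etaF : DeltaF ∘ etaF = etaF ⊗ etaF;
  pw_epsF_etaF : epsF ∘ etaF = id_unit A;

  pw_wreath : is_left_wreath mB etaB psi muM etaM;
  pw_cowreath : is_right_cowreath DeltaF epsF phi' DeltaC epsC;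
  pw_etaF_def : etaF = (F ⊗ epsB) ∘ etaM;
  pw_epsB_def : epsB = epsC ∘ (etaF ⊗ B);

  pw_DeltaB_etaB : DeltaB ∘ etaB = etaB ⊗ etaB;
  pw_epsF_mF : epsF ∘ mF = epsF ⊗ epsF;

  pw_eps_psi : (epsF ⊗ epsB) ∘ psi = epsB ⊗ epsF;
  pw_phi_eta : phi' ∘ (etaF ⊗ etaB) = etaB ⊗ etaF;
  pw_psi_def : psi = (l ⊗ r) ∘ (B ⊗ tauBF ⊗ F) ∘ (DeltaB ⊗ DeltaF);
  pw_phi_def : phi' = (mB ⊗ mF) ∘ (B ⊗ tauFB ⊗ F) ∘ (d ⊗ c);
  pw_tau : are_distributive_laws hopf_data_of;

  pw_lambdaB_PB : (B ⊗ lambdaB) ∘ (DeltaB ⊗ B) = hd_PB (D := hopf_data_of) psi;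
  pw_lambdaF_PF : (F ⊗ mF) ∘ (lambdaF ⊗ F) = hd_PF (D := hopf_data_of) phi';
  pw_muM_lambda : muM = (F ⊗ sigma) ∘ (lambdaF ⊗ F) ∘ (F ⊗ DeltaF);
  pw_DeltaC_lambda : DeltaC = (mB ⊗ B) ∘ (B ⊗ lambdaB) ∘ (rho' ⊗ B);

  pw_bimonad : is_tau_bimonad pw_opsFB pw_tauFBFB
}.

Definition is_canonical : Prop :=
  etaM = etaF ⊗ etaB /\ epsC = epsF ⊗ epsB.

End PairedWreath.

(* Main.v *)
(* When eta_M and eps'_C are canonical, the pairings of the wreath and cowreath
   axioms with the units and counits show that
     psi (B eta_F) = eta_F B,   mu_M (eta_F F) = F eta_B = mu_M (F eta_F),
     (eps_B F) phi' = F eps_B,  (eps_B B) Delta'_C = eps_F B = (B eps_B) Delta'_C.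
   Hence F eps_B and eps_F B are counital projections of FB, and F eta_B and
   eta_F B are unital inclusions into FB. Conditions (a)-(k) are the wreath
   (cowreath) axioms followed by a projection (preceded by an inclusion).
   Conditions (l) and the equations for Delta_B m_B and Delta_F m_F are the
   compatibility of multiplication and comultiplication of the bimonad FB, between
   two inclusions and two projections. As eta_F is a unit of m_F, the equation for
   P_F gives lambda_F explicitly, whence the formula for mu_M and P_F = Q_F on
   F Delta_F; dually for lambda_B. In each case the two 2-cells are compared as
   string diagrams, up to interchange, by cancelling units and counits. *)

Require Import Defs.
From HB Require Import structures.
From mathcomp Require Import all_boot.
From mathcomp Require Import boolp.

Set Implicit Arguments.
Unset Strict Implicit.
Unset Printing Implicit Defensive.

(** * 2-cells with unspecified source and target *)

Section Arrows.

Context (K : twoCategory) (A : K).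

(* In [option arrow], horizontal composition is associative and unital without
   transport; [None] is the vertical composite of non-composable 2-cells. *)
Record arrow := Arrow {
  asrc : endo1 A;
  atgt : endo1 A;
  acell : hom2 asrc atgt
}.

Definition pack (X Y : endo1 A) (f : hom2 X Y) : option arrow := Some (Arrow f).

Definition ahc (a b : option arrow) : option arrow :=
  if (a, b) is (Some (Arrow _ _ f), Some (Arrow _ _ g)) then pack (hcomp f g)
  else None.

(** Equality of 1-cells is not decidable in general, so composability is decided classically by
    [pselect], and [g] is transported along the equality obtained. *)
Definition avc (b a : option arrow) : option arrow :=
  if (a, b) is (Some (Arrow X Y f), Some (Arrow Y' Z g)) then
    match pselect (Y' = Y) with
    | left e => pack (vcomp (cast2 e erefl g) f)
    | right _ => None
    end
  else None.

Lemma avc_pack (X Y Z : endo1 A) (g : hom2 Y Z) (f : hom2 X Y) :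
  avc (pack g) (pack f) = pack (vcomp g f).
Proof.
rewrite /avc /pack; case: pselect => // e.
by rewrite (Prop_irrelevance e erefl).
Qed.

Lemma ahc_pack (X X' Y Y' : endo1 A) (f : hom2 X X') (g : hom2 Y Y') :
  ahc (pack f) (pack g) = pack (hcomp f g).
Proof. by []. Qed.

Lemma pack_cast (X X' Y Y' : endo1 A) (eX : X = X') (eY : Y = Y')
    (f : hom2 X Y) :
  pack (cast2 eX eY f) = pack f.
Proof. by case: X' / eX; case: Y' / eY. Qed.

(** The equalities of sources and targets extracted from an equality of arrows are loops, trivial by
    proof irrelevance. This brings equations between untyped arrows back to 2-cells. *)
Lemma pack_inj (X Y : endo1 A) (f g : hom2 X Y) : pack f = pack g -> f = g.
Proof.
move=> /Some_inj eq_fg.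
have cellE (a b : arrow) (e : a = b) :
    cast2 (congr1 asrc e) (congr1 atgt e) (acell a) = acell b.
  by case: b / e.
have := cellE _ _ eq_fg => /= <-.
move: (congr1 asrc _) (congr1 atgt _) => eX eY.
by rewrite (Prop_irrelevance eX erefl) (Prop_irrelevance eY erefl).
Qed.

Lemma ahcA (a b c : option arrow) : ahc a (ahc b c) = ahc (ahc a b) c.
Proof.
case: a b c => [[? ? f]|] [[? ? g]|] [[? ? h]|] //=.
by rewrite /ahc /= -hcompA pack_cast.
Qed.

Lemma ahc1l (a : option arrow) : ahc (pack (id2 (id1 A))) a = a.
Proof.
case: a => [[? ? f]|] //=.
by rewrite -[RHS]/(pack f) -[in RHS](hcomp1l f) pack_cast.
Qed.

Lemma ahc1r (a : option arrow) : ahc a (pack (id2 (id1 A))) = a.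
Proof.
case: a => [[? ? f]|] //=.
by rewrite -[RHS]/(pack f) -[in RHS](hcomp1r f) pack_cast.
Qed.

Lemma pack_tens (s s' t t' : seq (word A)) (f : cell s s') (g : cell t t') :
  pack (tens f g) = ahc (pack f) (pack g).
Proof. exact: pack_cast. Qed.

End Arrows.

(** * String diagrams *)

Section Diagrams.

Context (K : twoCategory) (A : K) (O G : eqType).
Context (ob : O -> endo1 A) (gdom gcod : G -> seq O).

Definition obs (s : seq O) : endo1 A := wprod (map ob s).

Context (gcell : forall g, hom2 (obs (gdom g)) (obs (gcod g))).

Definition typed (s t : seq O) (a : option (arrow A)) : Prop :=
  exists f : hom2 (obs s) (obs t), a = pack f.

Definition idm (s : seq O) : option (arrow A) := pack (id2 (obs s)).

Lemma obs_cat s t : comp1 (obs s) (obs t) = obs (s ++ t).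
Proof. by rewrite /obs map_cat wprod_cat. Qed.

Lemma typed_idm s : typed s s (idm s).
Proof. by exists (id2 _). Qed.

Lemma typed_ahc s t s' t' a b :
  typed s t a -> typed s' t' b -> typed (s ++ s') (t ++ t') (ahc a b).
Proof.
move=> [f ->] [g ->]; exists (cast2 (obs_cat s s') (obs_cat t t') (hcomp f g)).
by rewrite pack_cast.
Qed.

Lemma typed_avc s t u b a :
  typed t u b -> typed s t a -> typed s u (avc b a).
Proof. by move=> [g ->] [f ->]; exists (vcomp g f); rewrite avc_pack. Qed.

Lemma idm_cat s t : idm (s ++ t) = ahc (idm s) (idm t).
Proof.
rewrite /idm /ahc /= hcomp_id2; by case: _ / (obs_cat s t).
Qed.

Lemma ahc_idm0l a : ahc (idm [::]) a = a.
Proof. exact: ahc1l. Qed.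

Lemma ahc_idm0r a : ahc a (idm [::]) = a.
Proof. exact: ahc1r. Qed.

Lemma avc_idml s t a : typed s t a -> avc (idm t) a = a.
Proof. by move=> [f ->]; rewrite avc_pack vcomp1l. Qed.

Lemma avc_idmr s t a : typed s t a -> avc a (idm s) = a.
Proof. by move=> [f ->]; rewrite avc_pack vcomp1r. Qed.

Lemma avcA s t u v c b a :
  typed u v c -> typed t u b -> typed s t a -> avc c (avc b a) = avc (avc c b) a.
Proof. by move=> [h ->] [g ->] [f ->]; rewrite !avc_pack vcompA. Qed.

(** The typings make each pair of factors composable: composite 1-cells may coincide while their
    factors differ. *)
Lemma avc_ahc s t u s' t' u' b a b' a' :
  typed t u b -> typed s t a -> typed t' u' b' -> typed s' t' a' ->
  avc (ahc b b') (ahc a a') = ahc (avc b a) (avc b' a').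
Proof.
move=> [g ->] [f ->] [k ->] [h ->].
by rewrite !ahc_pack !avc_pack ahc_pack Defs.interchange.
Qed.

(* The layer [(u, g, v)] is the generator [g] with identities on [u] to its left
   and on [v] to its right; a diagram lists its layers from first to last. *)
Definition layer : Type := seq O * G * seq O.
Definition diagram : Type := seq layer.

Definition ldom (x : layer) := x.1.1 ++ gdom x.1.2 ++ x.2.
Definition lcod (x : layer) := x.1.1 ++ gcod x.1.2 ++ x.2.

Definition lcell (x : layer) : option (arrow A) :=
  ahc (idm x.1.1) (ahc (pack (gcell x.1.2)) (idm x.2)).

Fixpoint dcell (s : seq O) (d : diagram) : option (arrow A) :=
  if d is x :: d' then avc (dcell (lcod x) d') (lcell x) else idm s.

Fixpoint wf (s : seq O) (d : diagram) (t : seq O) : bool :=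
  if d is x :: d' then (s == ldom x) && wf (lcod x) d' t else s == t.

Lemma typed_gen g : typed (gdom g) (gcod g) (pack (gcell g)).
Proof. by exists (gcell g). Qed.

Lemma typed_lcell x : typed (ldom x) (lcod x) (lcell x).
Proof.
apply: typed_ahc; first exact: typed_idm.
by apply: typed_ahc; [exact: typed_gen | exact: typed_idm].
Qed.

Lemma typed_dcell s d t : wf s d t -> typed s t (dcell s d).
Proof.
elim: d s => [|x d IHd] s /=; first by move=> /eqP ->; exact: typed_idm.
by case/andP=> /eqP -> /IHd; move/typed_avc; apply; exact: typed_lcell.
Qed.

Lemma wf_cat s d1 d2 u :
  wf s (d1 ++ d2) u -> exists2 t, wf s d1 t & wf t d2 u.
Proof.
elim: d1 s => [|x d1 IHd] s /=; first by exists s.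
by case/andP=> -> /IHd [t wf1 wf2]; exists t.
Qed.

Lemma cat_wf s d1 t d2 u : wf s d1 t -> wf t d2 u -> wf s (d1 ++ d2) u.
Proof.
elim: d1 s => [|x d1 IHd] s /=; first by move=> /eqP ->.
by case/andP=> -> /IHd{}IHd /IHd.
Qed.

Lemma dcell_cat s d1 t d2 u :
  wf s d1 t -> wf t d2 u -> dcell s (d1 ++ d2) = avc (dcell t d2) (dcell s d1).
Proof.
move=> + wf2; elim: d1 s => [|x d1 IHd] s /=.
  by move=> /eqP ->; rewrite (avc_idmr (typed_dcell wf2)).
case/andP=> _ wf1; rewrite IHd //.
by rewrite (avcA (typed_dcell wf2) (typed_dcell wf1) (typed_lcell x)).
Qed.

Definition lwhisker (a b : seq O) (x : layer) : layer :=
  (a ++ x.1.1, x.1.2, x.2 ++ b).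

Definition whisker (a b : seq O) (d : diagram) : diagram :=
  map (lwhisker a b) d.

Lemma ldom_whisker a b x : ldom (lwhisker a b x) = a ++ ldom x ++ b.
Proof. by rewrite /ldom /= -!catA. Qed.

Lemma lcod_whisker a b x : lcod (lwhisker a b x) = a ++ lcod x ++ b.
Proof. by rewrite /lcod /= -!catA. Qed.

Lemma lcell_whisker a b x :
  lcell (lwhisker a b x) = ahc (idm a) (ahc (lcell x) (idm b)).
Proof. by rewrite /lcell /= !idm_cat !ahcA. Qed.

Lemma wf_whisker a b s d t :
  wf s d t -> wf (a ++ s ++ b) (whisker a b d) (a ++ t ++ b).
Proof.
elim: d s => [|x d IHd] s /=; first by move=> /eqP ->.
by case/andP=> /eqP -> /IHd; rewrite ldom_whisker lcod_whisker eqxx.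
Qed.

Lemma dcell_whisker a b s d t : wf s d t ->
  dcell (a ++ s ++ b) (whisker a b d) = ahc (idm a) (ahc (dcell s d) (idm b)).
Proof.
elim: d s => [|x d IHd] s /=; first by move=> _; rewrite !idm_cat.
case/andP=> _ wfd; rewrite lcod_whisker IHd // lcell_whisker.
have [ta tb] := (typed_idm a, typed_idm b).
have [tx td] := (typed_lcell x, typed_dcell wfd).
rewrite (avc_ahc ta ta (typed_ahc td tb) (typed_ahc tx tb)).
by rewrite (avc_ahc td tx tb tb) (avc_idml ta) (avc_idml tb).
Qed.

Definition equiv (s : seq O) (d d' : diagram) (t : seq O) : Prop :=
  wf s d' t /\ dcell s d = dcell s d'.

Lemma equiv_catl s d0 t d d' u :
  wf s d0 t -> wf t d u -> equiv t d d' u -> equiv s (d0 ++ d) (d0 ++ d') u.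
Proof.
move=> wf0 wfd [wfd' eqd]; split; first exact: cat_wf wf0 wfd'.
by rewrite (dcell_cat wf0 wfd) (dcell_cat wf0 wfd') eqd.
Qed.

Lemma equiv_catr s d d' t d0 u :
  wf s d t -> wf t d0 u -> equiv s d d' t -> equiv s (d ++ d0) (d' ++ d0) u.
Proof.
move=> wfd wf0 [wfd' eqd]; split; first exact: cat_wf wfd' wf0.
by rewrite (dcell_cat wfd wf0) (dcell_cat wfd' wf0) eqd.
Qed.

(** Here [m] is the strip of wires between [g] and [h]. Both orders reduce to [g] and [h] side by
    side once identities are absorbed. *)
Lemma interchange_layers u g m h v :
  let x := (u, g, m ++ gdom h ++ v) in
  let y := (u ++ gcod g ++ m, h, v) in
  let y' := (u ++ gdom g ++ m, h, v) in
  let x' := (u, g, m ++ gcod h ++ v) in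
  [/\ lcod x = ldom y, ldom x = ldom y', lcod y' = ldom x', lcod y = lcod x'
    & avc (lcell y) (lcell x) = avc (lcell x') (lcell y')].
Proof.
move=> x y y' x'; split; rewrite /ldom /lcod /= -?catA //.
rewrite /lcell /= !idm_cat -!ahcA.
have [tu tm tv] := And3 (typed_idm u) (typed_idm m) (typed_idm v).
have [tg th] := (typed_gen g, typed_gen h).
have [tdh tch] := (typed_idm (gdom h), typed_idm (gcod h)).
have [tdg tcg] := (typed_idm (gdom g), typed_idm (gcod g)).
rewrite !(avc_ahc tu tu (typed_ahc tcg (typed_ahc tm (typed_ahc th tv)))
  (typed_ahc tg (typed_ahc tm (typed_ahc tdh tv)))).
rewrite !(avc_ahc tu tu (typed_ahc tg (typed_ahc tm (typed_ahc tch tv)))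
  (typed_ahc tdg (typed_ahc tm (typed_ahc th tv)))).
rewrite (avc_ahc tcg tg (typed_ahc tm (typed_ahc th tv))
  (typed_ahc tm (typed_ahc tdh tv))).
rewrite (avc_ahc tg tdg (typed_ahc tm (typed_ahc tch tv))
  (typed_ahc tm (typed_ahc th tv))).
rewrite !(avc_ahc tm tm (typed_ahc th tv) (typed_ahc tdh tv)).
rewrite !(avc_ahc tm tm (typed_ahc tch tv) (typed_ahc th tv)).
rewrite (avc_ahc th tdh tv tv) (avc_ahc tch th tv tv).
by rewrite (avc_idml tg) (avc_idmr tg) (avc_idml th) (avc_idmr th).
Qed.

(** * Rewriting of diagrams *)

Record equation := Equation {
  eq_src : seq O;
  eq_lhs : diagram;
  eq_rhs : diagram;
  eq_tgt : seq O
}.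

Definition valid (e : equation) : Prop :=
  [/\ wf (eq_src e) (eq_lhs e) (eq_tgt e),
      wf (eq_src e) (eq_rhs e) (eq_tgt e)
    & dcell (eq_src e) (eq_lhs e) = dcell (eq_src e) (eq_rhs e)].

(* [to_left] tells on which side of the first generator the second one lies; both
   are possible when a layer without outputs meets one without inputs. *)
Definition swap_layers (to_left : bool) (x y : layer) : option (layer * layer) :=
  let: (u, g, w) := x in
  let: (u', h, w') := y in
  if to_left then
    let m := drop (size u' + size (gdom h)) u in
    if (u == u' ++ gdom h ++ m) && (w' == m ++ gcod g ++ w) then
      Some ((u', h, m ++ gdom g ++ w), (u' ++ gcod h ++ m, g, w))
    else None
  else
    let m := drop (size u + size (gcod g)) u' in
    if (u' == u ++ gcod g ++ m) && (w == m ++ gdom h ++ w') then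
      Some ((u ++ gdom g ++ m, h, w'), (u, g, m ++ gcod h ++ w'))
    else None.

Definition swap_at (to_left : bool) (i : nat) (d : diagram) : option diagram :=
  if drop i d is x :: y :: d' then
    if swap_layers to_left x y is Some (y', x') then
      Some (take i d ++ y' :: x' :: d')
    else None
  else None.

(** The strips beside a match are read off its first layer alone; [rewrite_at] then tests the whole
    block against them. *)
Definition match_context (x x0 : layer) : seq O * seq O :=
  (take (size x.1.1 - size x0.1.1) x.1.1, drop (size x0.2) x.2).

Definition rewrite_at (e : equation) (i : nat) (d : diagram) : option diagram :=
  if (drop i d, eq_lhs e) is (x :: _, x0 :: _) then
    let: (a, b) := match_context x x0 in
    let n := size (eq_lhs e) in
    if take n (drop i d) == whisker a b (eq_lhs e) then
      Some (take i d ++ whisker a b (eq_rhs e) ++ drop n (drop i d))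
    else None
  else None.

(* A move that does not apply leaves the diagram unchanged, so that any sequence
   of moves preserves the 2-cell denoted by a diagram. *)
Inductive move := Swap (to_left : bool) (i : nat) | Rewrite (k i : nat).

Definition exec (rules : seq equation) (mv : move) (d : diagram) : diagram :=
  match mv with
  | Swap to_left i => odflt d (swap_at to_left i d)
  | Rewrite k i =>
    if onth rules k is Some e then odflt d (rewrite_at e i d) else d
  end.

Lemma swap_layersP to_left x y y' x' :
  swap_layers to_left x y = Some (y', x') -> lcod x = ldom y ->
  [/\ ldom x = ldom y', lcod y' = ldom x', lcod y = lcod x'
    & avc (lcell y) (lcell x) = avc (lcell x') (lcell y')].
Proof.
case: x y => [[u g] w] [[u' h] w']; rewrite /swap_layers.
by case: to_left; set m := drop _ _; case: ifP => // /andP[/eqP -> /eqP ->];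
  case=> <- <- _; [have [] := interchange_layers u' h m g w
                 | have [] := interchange_layers u g m h w'].
Qed.

Lemma swap_atP to_left i s d d' t :
  swap_at to_left i d = Some d' -> wf s d t -> equiv s d d' t.
Proof.
rewrite /swap_at; move: (take i d) (drop i d) (cat_take_drop i d) => d1 d2 <-.
case: d2 => [|x [|y d2]] //.
case Exy: swap_layers => [[y' x']|] // [<-] /wf_cat[u wf1 wf2].
apply: (equiv_catl wf1 wf2); move: wf2 => /= /and3P[/eqP -> /eqP exy wf3].
have [e1 e2 e3 e4] := swap_layersP Exy exy.
split; first by rewrite /= e1 e2 eqxx -e3 eqxx.
have tx := typed_lcell x; rewrite exy in tx.
have tx' := typed_lcell x'; rewrite -e2 -e3 in tx'.
rewrite /= -e3 -(avcA (typed_dcell wf3) (typed_lcell y) tx) e4.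
by rewrite (avcA (typed_dcell wf3) tx' (typed_lcell y')).
Qed.

Lemma rewrite_atP e i s d d' t :
  valid e -> rewrite_at e i d = Some d' -> wf s d t -> equiv s d d' t.
Proof.
case=> wfl wfr eqlr; rewrite /rewrite_at.
move: (take i d) (drop i d) (cat_take_drop i d) => d1 d2 <-.
case Ed2: d2 => [|x d3] //; rewrite -Ed2.
case El: (eq_lhs e) => [|x0 l0] //.
case: (match_context x x0) => a b; rewrite -El; case: ifP => // /eqP Etake [<-].
move=> /wf_cat[u wf1 wf2]; apply: (equiv_catl wf1 wf2).
move: wf2; rewrite -{1 2}(cat_take_drop (size (eq_lhs e)) d2) Etake.
move=> /wf_cat[v wf2 wf3]; apply: (equiv_catr wf2 wf3).
have wfl' := wf_whisker a b wfl; have wfr' := wf_whisker a b wfr.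
have [-> ->] : u = a ++ eq_src e ++ b /\ v = a ++ eq_tgt e ++ b.
  (* A nonempty diagram determines its source and target, so the matched block has the whiskered
     boundary of the rule. *)
  have wf_fun s1 s2 t1 t2 d0 :
      d0 != [::] -> wf s1 d0 t1 -> wf s2 d0 t2 -> s1 = s2 /\ t1 = t2.
    case: d0 => // y d0 _ /= /andP[/eqP -> +] /andP[/eqP ->].
    elim: d0 (lcod y) => [|z d0 IHd] w /=; first by move=> /eqP -> /eqP.
    by case/andP=> _ /IHd{}IHd /andP[_ /IHd].
  by apply: wf_fun wf2 wfl'; rewrite El.
by split=> //; rewrite (dcell_whisker a b wfl) (dcell_whisker a b wfr) eqlr.
Qed.

Lemma execP rules mv s d t :
  (forall k e, onth rules k = Some e -> valid e) -> wf s d t ->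
  equiv s d (exec rules mv d) t.
Proof.
move=> Vr wfd; have refl : equiv s d d t by split.
case: mv => [to_left i | k i] /=.
  by case E: swap_at => [d'|] //; apply: swap_atP E wfd.
case Ek: onth => [e|] //; case E: rewrite_at => [d'|] //.
exact: rewrite_atP (Vr _ _ Ek) E wfd.
Qed.

Definition run (rules : seq equation) (d : diagram) (mvs : seq move) : diagram :=
  foldl (fun d mv => exec rules mv d) d mvs.

Lemma runP rules mvs s d t :
  (forall k e, onth rules k = Some e -> valid e) -> wf s d t ->
  equiv s d (run rules d mvs) t.
Proof.
move=> Vr; elim: mvs d => [|mv mvs IHm] d wfd; first by split.
have [wfd' eqd] := execP mv Vr wfd.
by have [wfd'' eqd'] := IHm _ wfd'; split=> //; rewrite eqd.
Qed.

(* From here to [align], moves are searched for; nothing needs to be proved about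
   the search, since whatever moves it finds are replayed by [run]. *)
Definition trace : Type := seq move * diagram.

(** As a number [up] is 1 or 0: layer [p] is exchanged with its predecessor or with its successor.
    Both values of [to_left] are tried and all outcomes kept. *)
Fixpoint bubble (up : bool) (n p : nat) (d : diagram) : seq trace :=
  if n is n'.+1 then
    flatten [seq (if swap_at to_left (p - up) d is Some d' then
                    [seq (Swap to_left (p - up) :: r.1, r.2)
                    | r <- bubble up n' (if up then p.-1 else p.+1) d']
                  else [::]) | to_left <- [:: false; true]]
  else [:: ([::], d)].

Definition expected (e : equation) (d : diagram) (j i : nat) : option layer :=
  if (onth d j, onth (eq_lhs e) 0, onth (eq_lhs e) i)
    is (Some x, Some x0, Some y)
  then let: (a, b) := match_context x x0 in Some (lwhisker a b y) else None.

(* Layers [j], ..., [j + i - 1] of [d] match the first [i] layers of the left-hand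
   side of [e]. The next one is brought there from below or from above; failing
   that, a layer that may be blocking it is moved above the matched block. *)
Fixpoint extend (fuel : nat) (e : equation) (mvs : seq move) (d : diagram)
    (j i : nat) : option (seq move * diagram * nat) :=
  if fuel is fuel'.+1 then
    if i == size (eq_lhs e) then Some (mvs, d, j) else
    let later := iota (j + i) (size d - (j + i)) in
    let from_below := flatten [seq
        [seq r <- bubble true (p - (j + i)) p d
        | onth r.2 (j + i) == expected e r.2 j i] | p <- later] in
    if from_below is r :: _ then extend fuel' e (mvs ++ r.1) r.2 j i.+1 else
    (* Pulling an earlier layer down past the block shifts the block one place toward the start,
       whence the predecessors. *)
    let from_above := flatten [seq
        [seq r <- bubble false (j + i - p.+1) p d
        | onth r.2 (j + i).-1 == expected e r.2 j.-1 i] | p <- iota 0 j] in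
    if from_above is r :: _ then extend fuel' e (mvs ++ r.1) r.2 j.-1 i.+1 else
    let aside := flatten [seq bubble true (p - j) p d | p <- later] in
    if aside is r :: _ then extend fuel' e (mvs ++ r.1) r.2 j.+1 i else None
  else None.

Definition same_gen (x y : option layer) : bool :=
  if (x, y) is (Some x', Some y') then x'.1.2 == y'.1.2 else false.

Fixpoint first_some (T U : Type) (f : T -> option U) (s : seq T) : option U :=
  if s is x :: s' then if f x is Some y then Some y else first_some f s'
  else None.

Definition rewrite_step (rules : seq equation) (d : diagram) : option trace :=
  let gens := [seq x.1.2 | x <- d] in
  first_some (fun ke : nat * equation => let: (k, e) := ke in
    if all (fun x : layer => x.1.2 \in gens) (eq_lhs e) then
      first_some (fun j =>
        if same_gen (onth d j) (onth (eq_lhs e) 0) then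
          if extend 30 e [::] d j 1 is Some (mvs, d', j') then
            if rewrite_at e j' d' is Some d'' then
              Some (rcons mvs (Rewrite k j'), d'')
            else None
          else None
        else None) (iota 0 (size d))
    else None) (zip (iota 0 (size rules)) rules).

Fixpoint normalize (fuel : nat) (rules : seq equation) (mvs : seq move)
    (d : diagram) : trace :=
  if fuel is fuel'.+1 then
    if rewrite_step rules d is Some r then
      normalize fuel' rules (mvs ++ r.1) r.2
    else (mvs, d)
  else (mvs, d).

(** A selection sort with backtracking: layer [i] of [d'] is sought among the layers of [d] from [i]
    on and brought to place [i] by interchanges. *)
Fixpoint align (n : nat) (mvs : seq move) (d d' : diagram) :
    option (seq move) :=
  if n is n'.+1 then
    let i := size d' - n in
    let candidates := flatten [seq
        [seq r <- bubble true (p - i) p d | onth r.2 i == onth d' i]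
        | p <- iota i n] in
    first_some (fun r => align n' (mvs ++ r.1) r.2 d') candidates
  else Some mvs.

(** * Expressions for 2-cells *)

Inductive term :=
  | TId of seq O
  | TGen of G
  | TVert of term & term
  | TTens of term & term.

Fixpoint tcell (T : term) : option (arrow A) :=
  match T with
  | TId s => idm s
  | TGen g => pack (gcell g)
  | TVert T2 T1 => avc (tcell T2) (tcell T1)
  | TTens T1 T2 => ahc (tcell T1) (tcell T2)
  end.

Fixpoint tsrc (T : term) : seq O :=
  match T with
  | TId s => s
  | TGen g => gdom g
  | TVert T2 T1 => tsrc T1
  | TTens T1 T2 => tsrc T1 ++ tsrc T2
  end.

Fixpoint ttgt (T : term) : seq O :=
  match T with
  | TId s => s
  | TGen g => gcod g
  | TVert T2 T1 => ttgt T2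
  | TTens T1 T2 => ttgt T1 ++ ttgt T2
  end.

Fixpoint tdiag (T : term) : diagram :=
  match T with
  | TId s => [::]
  | TGen g => [:: ([::], g, [::])]
  | TVert T2 T1 => tdiag T1 ++ tdiag T2
  | TTens T1 T2 =>
    whisker [::] (tsrc T2) (tdiag T1) ++ whisker (ttgt T1) [::] (tdiag T2)
  end.

Fixpoint twf (T : term) : bool :=
  match T with
  | TId _ | TGen _ => true
  | TVert T2 T1 => [&& twf T1, twf T2 & ttgt T1 == tsrc T2]
  | TTens T1 T2 => twf T1 && twf T2
  end.

Lemma tdiagP T : twf T ->
  wf (tsrc T) (tdiag T) (ttgt T) /\ tcell T = dcell (tsrc T) (tdiag T).
Proof.
elim: T => [s|g|T2 IH2 T1 IH1|T1 IH1 T2 IH2] /=.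
- by rewrite eqxx.
- move=> _; rewrite /ldom /lcod /= !cats0 !eqxx; split=> //.
  by rewrite /lcell /= ahc_idm0l ahc_idm0r (avc_idml (typed_gen g)).
- case/and3P=> /IH1[wf1 e1] /IH2[wf2 e2] /eqP e12.
  rewrite -e12 in wf2 e2.
  by split; [exact: cat_wf wf1 wf2 | rewrite (dcell_cat wf1 wf2) -e1 -e2].
- case/andP=> /IH1[wf1 e1] /IH2[wf2 e2].
  have := wf_whisker [::] (tsrc T2) wf1; have := wf_whisker (ttgt T1) [::] wf2.
  rewrite /= !cats0 => wf2' wf1'.
  split; first exact: cat_wf wf1' wf2'.
  rewrite (dcell_cat wf1' wf2').
  have := dcell_whisker [::] (tsrc T2) wf1.
  have := dcell_whisker (ttgt T1) [::] wf2.
  rewrite /= !cats0 => -> ->; rewrite ahc_idm0l ahc_idm0r -e1 -e2.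
  have [t1 t2] := (typed_dcell wf1, typed_dcell wf2); rewrite -e1 -e2 in t1 t2.
  (* Interchange: a tensor product is its left factor beside the source of the right one, followed
     by the right factor beside the target of the left one. *)
  rewrite (avc_ahc (typed_idm _) t1 t2 (typed_idm _)).
  by rewrite (avc_idml t1) (avc_idmr t2).
Qed.

Fixpoint all_hold (eqs : seq (term * term)) : Prop :=
  if eqs is e :: eqs' then tcell e.1 = tcell e.2 /\ all_hold eqs' else True.

Definition equation_of (e : term * term) : equation :=
  Equation (tsrc e.1) (tdiag e.1) (tdiag e.2) (ttgt e.1).

Definition parallel (e : term * term) : bool :=
  [&& twf e.1, twf e.2, tsrc e.1 == tsrc e.2 & ttgt e.1 == ttgt e.2].

Definition rules_of (eqs : seq (term * term)) : seq equation :=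
  [seq equation_of e | e <- eqs & parallel e].

Lemma rules_of_valid eqs k e :
  all_hold eqs -> onth (rules_of eqs) k = Some e -> valid e.
Proof.
move=> hold; rewrite /rules_of.
elim: eqs k hold => [|[T1 T2] eqs IHe] k; first by case: k.
case=> /= eqT hold; case: ifP => [|_]; last exact: IHe.
case/and4P=> /= wf1 wf2 /eqP es /eqP et.
case: k => [|k] /=; last exact: IHe hold.
case=> <-; rewrite /valid /=.
have [wf1' e1] := tdiagP wf1; have [wf2' e2] := tdiagP wf2.
by rewrite es et in wf1' e1 *; split=> //; rewrite -e1 -e2.
Qed.

(** A certificate checked by computation: the recorded moves take both sides to literally the same
    list of layers. *)
Definition joined (eqs : seq (term * term)) (T1 T2 : term)
    (mvs : seq move * seq move) : bool :=
  let rules := rules_of eqs in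
  parallel (T1, T2)
  && (run rules (tdiag T1) mvs.1 == run rules (tdiag T2) mvs.2).

Lemma joined_sound eqs T1 T2 mvs :
  all_hold eqs -> joined eqs T1 T2 mvs -> tcell T1 = tcell T2.
Proof.
move=> hold /andP[/and4P[/= wf1 wf2 /eqP es /eqP et] /eqP eqd].
have [wf1' ->] := tdiagP wf1; have [wf2' ->] := tdiagP wf2.
have Vr := fun k e => @rules_of_valid eqs k e hold.
have [_ ->] := runP mvs.1 Vr wf1'.
by have [_ ->] := runP mvs.2 Vr wf2'; rewrite eqd es.
Qed.

Definition find_moves (eqs : seq (term * term)) (T1 T2 : term) :
    seq move * seq move :=
  let rules := rules_of eqs in
  let r1 := normalize 100 rules [::] (tdiag T1) in
  let r2 := normalize 100 rules [::] (tdiag T2) in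
  (odflt [::] (align (size r2.2) r1.1 r1.2 r2.2), r2.1).

End Diagrams.

(** * The 2-cells of a paired wreath *)

Inductive generator :=
  | Gm_B | Geta_B | Geps_B | GDelta_F | Geps_F | Geta_F
  | Gpsi | Gmu_M | Geta_M | Gphi' | GDelta_C | Geps_C
  | Gtau_BB | Gtau_BF | Gtau_FB | Gtau_FF | Glambda_B | Glambda_F.

Definition generator_eq_dec (g h : generator) : {g = h} + {g <> h}.
Proof. decide equality. Defined.

HB.instance Definition _ := hasDecEq.Build generator (compareP generator_eq_dec).

(* [true] is the letter B and [false] the letter F. *)
Definition gen_dom (g : generator) : seq bool :=
  match g with
  | Gm_B | Gtau_BB | Glambda_B => [:: true; true]
  | Geps_B => [:: true]
  | Geta_B | Geta_F | Geta_M => [::]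
  | GDelta_F | Geps_F => [:: false]
  | Gpsi | Gtau_BF => [:: true; false]
  | Gphi' | GDelta_C | Geps_C | Gtau_FB => [:: false; true]
  | Gmu_M | Gtau_FF | Glambda_F => [:: false; false]
  end.

Definition gen_cod (g : generator) : seq bool :=
  match g with
  | Gm_B | Geta_B => [:: true]
  | Geta_F => [:: false]
  | Geps_B | Geps_F | Geps_C => [::]
  | GDelta_F | Gtau_FF | Glambda_F => [:: false; false]
  | Gpsi | Gmu_M | Geta_M | Gtau_BF => [:: false; true]
  | Gphi' | Gtau_FB => [:: true; false]
  | GDelta_C | Gtau_BB | Glambda_B => [:: true; true]
  end.

Section Generators.

Context (K : twoCategory) (A : K) (W : wreath_data A).

Definition pw_ob (o : bool) : endo1 A := if o then pw_B W else pw_F W.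

(** Each branch typechecks by conversion: on concrete words, [obs] and [hprod] compute to the same
    1-cell. *)
Definition gen_cell (g : generator) :
    hom2 (obs pw_ob (gen_dom g)) (obs pw_ob (gen_cod g)) :=
  match g with
  | Gm_B => pw_mB W
  | Geta_B => pw_etaB W
  | Geps_B => pw_epsB W
  | GDelta_F => pw_DeltaF W
  | Geps_F => pw_epsF W
  | Geta_F => pw_etaF W
  | Gpsi => pw_psi W
  | Gmu_M => pw_muM W
  | Geta_M => pw_etaM W
  | Gphi' => pw_phi' W
  | GDelta_C => pw_DeltaC W
  | Geps_C => pw_epsC W
  | Gtau_BB => pw_tauBB W
  | Gtau_BF => pw_tauBF W
  | Gtau_FB => pw_tauFB W
  | Gtau_FF => pw_tauFF W
  | Glambda_B => pw_lambdaB W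
  | Glambda_F => pw_lambdaF W
  end.

Local Notation tcell := (tcell gen_cell).

(** * Reification of 2-cells as expressions *)

Lemma reify_tens (s s' t t' : seq (word A)) (f : cell s s') (g : cell t t') Tf Tg :
  pack f = tcell Tf -> pack g = tcell Tg ->
  pack (tens f g) = tcell (TTens Tf Tg).
Proof. by rewrite pack_tens => -> ->. Qed.

Lemma reify_vert (s t u : seq (word A)) (g : cell t u) (f : cell s t) Tg Tf :
  pack g = tcell Tg -> pack f = tcell Tf ->
  pack (vert g f) = tcell (TVert Tg Tf).
Proof. by rewrite /= => <- <-; rewrite avc_pack. Qed.

Lemma reify_eq (s t : seq (word A)) (f g : cell s t) Tf Tg :
  pack f = tcell Tf -> pack g = tcell Tg -> f = g -> tcell Tf = tcell Tg.
Proof. by move=> <- <- ->. Qed.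

Lemma diagram_eq eqs mvs (s t : seq (word A)) (f g : cell s t) Tf Tg :
  all_hold gen_cell eqs -> pack f = tcell Tf -> pack g = tcell Tg ->
  joined gen_dom gen_cod eqs Tf Tg mvs -> f = g.
Proof.
move=> hold ef eg join; apply: pack_inj.
by rewrite ef eg; exact: (joined_sound hold join).
Qed.

Lemma all_hold_cons e eqs :
  tcell e.1 = tcell e.2 -> all_hold gen_cell eqs -> all_hold gen_cell (e :: eqs).
Proof. by []. Qed.

Lemma all_hold_cat eqs eqs' :
  all_hold gen_cell eqs -> all_hold gen_cell eqs' ->
  all_hold gen_cell (eqs ++ eqs').
Proof. by elim: eqs => //= e eqs IHe [? /IHe{}IHe] /IHe. Qed.

Record rule_set := RuleSet {
  rule_terms : seq (term bool generator * term bool generator);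
  rule_hold : all_hold gen_cell rule_terms
}.

Definition add_rules (R R' : rule_set) : rule_set :=
  RuleSet (all_hold_cat (rule_hold R) (rule_hold R')).

End Generators.

(** Derived 2-cells such as [mF], [DeltaB] and [l] are expanded into generators, so that rules see
    [muM], [DeltaC] and [psi] meeting units and counits. *)
Ltac unfold_cells e :=
  eval lazy beta iota delta [
    op_m op_eta op_Delta op_eps hd_B hd_F hd_opsB hd_opsF hd_l hd_r hd_c hd_d
    hd_sigma hd_rho' hd_tauBB hd_tauBF hd_tauFB hd_tauFF hd_PB hd_PF hd_QB
    hd_QF hd_etaM hd_epsC hd_psi hd_phi' hd_muM hd_DeltaC
    hopf_data_of pw_mF pw_DeltaB pw_l pw_r pw_c pw_d
    pw_sigma pw_rho' pw_FB pw_mFB pw_DeltaFB pw_tauFBFB pw_opsFB letter] in e.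

Ltac reify W f :=
  let G := constr:(gen_cell W) in
  let gen g := constr:(erefl : pack f = tcell G (TGen _ g)) in
  let ident s := constr:(erefl : pack f = tcell G (TId _ s)) in
  lazymatch f with
  | @tens _ _ ?s ?s' ?t ?t' ?f1 ?f2 =>
    let p1 := reify W f1 in
    let p2 := reify W f2 in
    constr:(@reify_tens _ _ W s s' t t' f1 f2 _ _ p1 p2)
  | @vert _ _ ?s ?t ?u ?f2 ?f1 =>
    let p2 := reify W f2 in
    let p1 := reify W f1 in
    constr:(@reify_vert _ _ W s t u f2 f1 _ _ p2 p1)
  | idw [:: pw_B W] => ident [:: true]
  | idw [:: pw_F W] => ident [:: false]
  | idw [:: pw_F W; pw_B W] => ident [:: false; true]
  | id_unit _ => ident (@nil bool)
  | pw_mB W => gen Gm_B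
  | pw_etaB W => gen Geta_B
  | pw_epsB W => gen Geps_B
  | pw_DeltaF W => gen GDelta_F
  | pw_epsF W => gen Geps_F
  | pw_etaF W => gen Geta_F
  | pw_psi W => gen Gpsi
  | pw_muM W => gen Gmu_M
  | pw_etaM W => gen Geta_M
  | pw_phi' W => gen Gphi'
  | pw_DeltaC W => gen GDelta_C
  | pw_epsC W => gen Geps_C
  | pw_tauBB W => gen Gtau_BB
  | pw_tauBF W => gen Gtau_BF
  | pw_tauFB W => gen Gtau_FB
  | pw_tauFF W => gen Gtau_FF
  | pw_lambdaB W => gen Glambda_B
  | pw_lambdaF W => gen Glambda_F
  end.

Ltac reify_rules W E hold :=
  let T := type of E in
  lazymatch T with
  | prod _ _ =>
    let hold1 := reify_rules W constr:(E.1) hold in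
    reify_rules W constr:(E.2) hold1
  | @eq ?C ?f ?g =>
    let f' := unfold_cells f in
    let g' := unfold_cells g in
    let p := reify W f' in
    let q := reify W g' in
    lazymatch type of p with _ = tcell _ ?Tf =>
    lazymatch type of q with _ = tcell _ ?Tg =>
      constr:(@all_hold_cons _ _ W (Tf, Tg) _ (reify_eq p q E) hold)
    end end
  end.

Ltac rules_from W E :=
  let hold := reify_rules W E (I : all_hold (gen_cell W) [::]) in
  exact (RuleSet hold).

(* Proves an equation of 2-cells whose sides have the same normal form, modulo
   interchange, with respect to the oriented equations in [R]. *)
Ltac diagram_rules W R :=
  lazymatch goal with |- ?f = ?g =>
    let f' := unfold_cells f in
    let g' := unfold_cells g in
    let p := reify W f' in
    let q := reify W g' in
    lazymatch type of p with _ = tcell _ ?Tf =>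
    lazymatch type of q with _ = tcell _ ?Tg =>
      (* The search runs here once; only the moves found enter the proof, where they are
         replayed. *)
      let mvs := eval vm_compute in
        (find_moves gen_dom gen_cod (rule_terms R) Tf Tg) in
      refine (@diagram_eq _ _ W (rule_terms R) mvs _ _ _ _ _ _
        (rule_hold R) p q _);
      vm_compute; reflexivity
    end end
  end.

Ltac derive_from E := refine (eq_trans _ (eq_trans E _)).

(** * The Hopf datum of a paired wreath *)

Section HopfDatumOfPairedWreath.

Context (K : twoCategory) (A : K) (W : wreath_data A).
Context (pw : is_paired_wreath W) (can : is_canonical W).
Local Open Scope cell_scope.
Local Notation B := (pw_B W).
Local Notation F := (pw_F W).
Local Notation mB := (pw_mB W).
Local Notation etaB := (pw_etaB W).
Local Notation epsB := (pw_epsB W).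
Local Notation DeltaF := (pw_DeltaF W).
Local Notation epsF := (pw_epsF W).
Local Notation etaF := (pw_etaF W).
Local Notation psi := (pw_psi W).
Local Notation muM := (pw_muM W).
Local Notation phi' := (pw_phi' W).
Local Notation DeltaC := (pw_DeltaC W).
Local Notation tauBB := (pw_tauBB W).
Local Notation tauBF := (pw_tauBF W).
Local Notation tauFB := (pw_tauFB W).
Local Notation tauFF := (pw_tauFF W).
Local Notation lambdaF := (pw_lambdaF W).
Local Notation lambdaB := (pw_lambdaB W).
Local Notation mF := (pw_mF W).
Local Notation DeltaB := (pw_DeltaB W).
Local Notation l := (pw_l W).
Local Notation r := (pw_r W).
Local Notation c := (pw_c W).
Local Notation d := (pw_d W).
Local Notation D := (hopf_data_of W).

(** * The axioms as oriented rewrite rules *)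

Lemma distributive_law_units (X Y : word A) (oX : ops X) (oY : ops Y)
    (tau : cell [:: X; Y] [:: Y; X]) :
  is_distributive_law oX oY tau ->
  ((tau ∘ (op_eta oX ⊗ Y) = Y ⊗ op_eta oX)
   * (tau ∘ (X ⊗ op_eta oY) = op_eta oY ⊗ X)
   * ((op_eps oY ⊗ X) ∘ tau = X ⊗ op_eps oY)
   * ((Y ⊗ op_eps oX) ∘ tau = op_eps oX ⊗ Y))%type.
Proof. by case. Qed.

Lemma monadBE :
  ((mB ∘ (mB ⊗ B) = mB ∘ (B ⊗ mB)) * (mB ∘ (etaB ⊗ B) = B)
   * (mB ∘ (B ⊗ etaB) = B))%type.
Proof. by case: (pw_monadB pw). Qed.

Lemma comonadFE :
  (((DeltaF ⊗ F) ∘ DeltaF = (F ⊗ DeltaF) ∘ DeltaF) * ((epsF ⊗ F) ∘ DeltaF = F)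
   * ((F ⊗ epsF) ∘ DeltaF = F))%type.
Proof. by case: (pw_comonadF pw). Qed.

Let wreath := pw_wreath pw.
Let cowreath := pw_cowreath pw.

Definition monad_rules : rule_set W.
Proof. rules_from W (monadBE, comonadFE). Defined.

Definition unit_rules : rule_set W.
Proof.
rules_from W (can.1, can.2, pw_epsB_mB pw, pw_epsB_etaB pw, pw_DeltaF_etaF pw,
  pw_epsF_etaF pw, pw_DeltaB_etaB pw, pw_epsF_mF pw, pw_eps_psi pw,
  pw_phi_eta pw).
Defined.

(** The orientation delays [mB] until after [psi] and advances [DeltaF] before [phi']. *)
Definition exchange_rules : rule_set W.
Proof.
rules_from W (lw_psi_m wreath, lw_psi_eta wreath,
  esym (rc_phi_Delta cowreath), rc_phi_eps cowreath).
Defined.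

Definition tau_rules : rule_set W.
Proof.
rules_from W (distributive_law_units (tauBB_law (pw_tau pw)),
  distributive_law_units (tauBF_law (pw_tau pw)),
  distributive_law_units (tauFB_law (pw_tau pw)),
  distributive_law_units (tauFF_law (pw_tau pw))).
Defined.

Definition axiom_rules : rule_set W :=
  add_rules (add_rules monad_rules unit_rules)
    (add_rules exchange_rules tau_rules).

(** Once [etaM] splits as [etaF ⊗ etaB], [mB] absorbs [etaB] on both sides of the axiom. *)
Lemma psi_etaF : psi ∘ (B ⊗ etaF) = etaF ⊗ B.
Proof.
derive_from (esym (lw_etaM_psi wreath)); diagram_rules W axiom_rules.
Qed.

Lemma muM_etaF :
  ((muM ∘ (etaF ⊗ F) = F ⊗ etaB) * (muM ∘ (F ⊗ etaF) = F ⊗ etaB))%type.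
Proof.
split.
- derive_from (lw_muM_unitl wreath); diagram_rules W axiom_rules.
- derive_from (esym (lw_muM_unitr wreath)); diagram_rules W axiom_rules.
Qed.

Lemma epsB_phi : (epsB ⊗ F) ∘ phi' = F ⊗ epsB.
Proof. derive_from (rc_epsC_phi cowreath); diagram_rules W axiom_rules. Qed.

Lemma epsB_DeltaC :
  (((epsB ⊗ B) ∘ DeltaC = epsF ⊗ B) * ((B ⊗ epsB) ∘ DeltaC = epsF ⊗ B))%type.
Proof.
split.
- derive_from (esym (rc_DeltaC_counitl cowreath)); diagram_rules W axiom_rules.
- derive_from (rc_DeltaC_counitr cowreath); diagram_rules W axiom_rules.
Qed.

Definition derived_rules : rule_set W.
Proof. rules_from W (psi_etaF, muM_etaF, epsB_phi, epsB_DeltaC). Defined.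

Definition rules : rule_set W := add_rules axiom_rules derived_rules.

Ltac diagram := diagram_rules W rules.

(* Since [etaF] is a right unit of [mF], P_F determines [lambdaF]. *)
Lemma lambdaFE :
  lambdaF = (mF ⊗ F) ∘ (F ⊗ l ⊗ F) ∘ (F ⊗ B ⊗ tauFF) ∘ (F ⊗ d ⊗ F)
    ∘ (DeltaF ⊗ F).
Proof.
derive_from (congr1 (fun f => f ∘ (F ⊗ F ⊗ etaF)) (pw_lambdaF_PF pw)); diagram.
Qed.

(** Dually, [epsB] is a left counit of [DeltaB], so composing P_B with [epsB] on its first output
    isolates [lambdaB]. *)
Lemma lambdaBE :
  lambdaB = (B ⊗ mB) ∘ (B ⊗ r ⊗ B) ∘ (tauBB ⊗ F ⊗ B) ∘ (B ⊗ c ⊗ B)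
    ∘ (B ⊗ DeltaB).
Proof.
derive_from (congr1 (fun f => (epsB ⊗ B ⊗ B) ∘ f) (pw_lambdaB_PB pw)); diagram.
Qed.

Lemma hd_psiE : hd_psi D = psi.
Proof. exact/esym/(pw_psi_def pw). Qed.

Lemma hd_phiE : hd_phi' D = phi'.
Proof. exact/esym/(pw_phi_def pw). Qed.

Lemma hd_muME : hd_muM D = muM.
Proof.
by derive_from (esym (pw_muM_lambda pw)); [rewrite lambdaFE; diagram |].
Qed.

Lemma hd_DeltaCE : hd_DeltaC D = DeltaC.
Proof.
by derive_from (esym (pw_DeltaC_lambda pw)); [rewrite lambdaBE; diagram |].
Qed.

(** On each input copy of FB, [etaF ⊗ B] selects the letter B and [F ⊗ etaB] selects F; on each
    output copy, [epsF ⊗ B] and [F ⊗ epsB] do the same. Inputs BF, FF, BB turn the product into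
    [psi], [muM], [etaF ⊗ mB]; outputs BF, BB, FF turn the coproduct into [phi'], [DeltaC],
    [DeltaF ⊗ epsB]. *)
Let bim := bim_Delta_m (pw_bimonad pw).

Lemma hopf_datum_of_paired_wreath : is_hopf_datum D.
Proof.
(* Normalization alone settles the unit and counit conditions, the module and comodule laws, (e),
   (f) and (k). *)
split; rewrite ?hd_psiE ?hd_phiE ?hd_muME ?hd_DeltaCE; try diagram.
- exact: pw_monadB.
- exact: pw_comonadF.
- exact: pw_tau.
(* (a) *)
- derive_from (congr1 (fun f => (F ⊗ epsB) ∘ f) (lw_muM_psi wreath)); diagram.
(* (b) *)
- derive_from (congr1 (fun f => f ∘ (etaF ⊗ B)) (esym (rc_DeltaC_phi cowreath)));
    diagram.
(* (c) *)
- derive_from (congr1 (fun f => (F ⊗ epsB) ∘ f) (lw_muM_assoc wreath)); diagram.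
(* (d) *)
- derive_from (congr1 (fun f => f ∘ (etaF ⊗ B))
    (esym (rc_DeltaC_coassoc cowreath))); diagram.
(* (g) *)
- derive_from (congr1 (fun f => (epsF ⊗ B) ∘ f) (lw_muM_psi wreath)); diagram.
(* (h) *)
- derive_from (congr1 (fun f => f ∘ (F ⊗ etaB)) (rc_DeltaC_phi cowreath));
    diagram.
(* (i) *)
- derive_from (congr1 (fun f => (epsF ⊗ B) ∘ f) (lw_muM_assoc wreath)); diagram.
(* (j) *)
- derive_from (congr1 (fun f => f ∘ (F ⊗ etaB)) (rc_DeltaC_coassoc cowreath));
    diagram.
(* (l1) *)
- derive_from (congr1 (fun f =>
    (epsF ⊗ B ⊗ F ⊗ epsB) ∘ f ∘ (etaF ⊗ B ⊗ F ⊗ etaB)) bim); diagram.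
(* (l2) *)
- derive_from (congr1 (fun f =>
    (epsF ⊗ B ⊗ epsF ⊗ B) ∘ f ∘ (etaF ⊗ B ⊗ F ⊗ etaB)) bim); diagram.
(* (l3) *)
- derive_from (congr1 (fun f =>
    (F ⊗ epsB ⊗ F ⊗ epsB) ∘ f ∘ (etaF ⊗ B ⊗ F ⊗ etaB)) bim); diagram.
(* (l4) *)
- derive_from (congr1 (fun f =>
    (epsF ⊗ B ⊗ F ⊗ epsB) ∘ f ∘ (F ⊗ etaB ⊗ F ⊗ etaB)) bim); diagram.
(* (l5) *)
- derive_from (congr1 (fun f =>
    (epsF ⊗ B ⊗ epsF ⊗ B) ∘ f ∘ (F ⊗ etaB ⊗ F ⊗ etaB)) bim); diagram.
(* (l6) *)
- derive_from (congr1 (fun f =>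
    (epsF ⊗ B ⊗ F ⊗ epsB) ∘ f ∘ (etaF ⊗ B ⊗ etaF ⊗ B)) bim); diagram.
(* (m) *)
- derive_from (congr1 (fun f =>
    (epsF ⊗ B ⊗ epsF ⊗ B) ∘ f ∘ (etaF ⊗ B ⊗ etaF ⊗ B)) bim); diagram.
(* P_B is traded for [lambdaB] after [DeltaB], and the explicit [lambdaB] then yields Q_B; the last
   case is dual. *)
- derive_from (congr1 (fun f => (mB ⊗ B) ∘ f) (esym (pw_lambdaB_PB pw)));
    rewrite ?lambdaBE; diagram.
- derive_from (congr1 (fun f =>
    (F ⊗ epsB ⊗ F ⊗ epsB) ∘ f ∘ (F ⊗ etaB ⊗ F ⊗ etaB)) bim); diagram.
- derive_from (congr1 (fun f => f ∘ (F ⊗ DeltaF)) (esym (pw_lambdaF_PF pw)));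
    rewrite ?lambdaFE; diagram.
Qed.

End HopfDatumOfPairedWreath.

Theorem corollary4p3 (K : twoCategory) (A : K) (W : wreath_data A) :
  is_paired_wreath W -> is_canonical W ->
  let D := hopf_data_of W in
  is_hopf_datum D /\
  hd_psi D = pw_psi W /\ hd_phi' D = pw_phi' W /\
  hd_muM D = pw_muM W /\ hd_DeltaC D = pw_DeltaC W.
Proof.
move=> pw can; split; first exact: hopf_datum_of_paired_wreath.
by rewrite hd_psiE // hd_phiE // hd_muME // hd_DeltaCE.
Qed.
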